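(* Let $k \geq 3$ be an integer and let $F$ be a graph with exactly $k$ edges and $\gamma(F) = 1$. Let $G$ be a connected graph with exactly $m$ edges. Then \[\iota(G,F) = \frac{m+1}{k+2}\] if and only if $G$ is a pure $(m,F)$-special graph or $G$ is a copy of $F+e$ for some $e \in E(\overline{F})$.
   Context: All graphs are finite and simple. For a graph $G$ and $D \subseteq V(G)$, $N_G[D]$ is the closed neighbourhood $\bigcup_{v \in D}(\{v\} \cup N_G(v))$ and $G - X$ is the subgraph induced by $V(G)\setminus X$. A copy of $F$ (an $F$-copy) is a graph isomorphic to $F$. A set $D \subseteq V(G)$ is an $F$-isolating set of $G$ if $G - N_G[D]$ contains no subgraph isomorphic to $F$; $\iota(G,F)$ is the minimum size of an $F$-isolating set of $G$. $\gamma(F)=1$ means $F$ has a vertex adjacent to all other vertices of $F$ (a dominating vertex). $\overline{F}$ is the complement of $F$, and for $e \in E(\overline{F})$, $F+e$ is the graph $(V(F), E(F)\cup\{e\})$. ($m,F$)-special graphs: let $F$ be a connected $k$-edge graph. Write $m+1 = q(k+2)+r$ with integers $q \ge 0$, $0 \le r \le k+1$. If $q = 0$, an $(m,F)$-special graph is any connected $m$-edge graph. If $q \geq 1$, take distinct vertices $v_1,\dots,v_q$, copies $F_1,\dots,F_q$ of $F$ such that $V(F_1),\dots,V(F_q),\{v_1,\dots,v_q\}$ are pairwise disjoint, vertices $w_i \in V(F_i)$, and let $G_i$ be the graph with vertex set $\{v_i\}\cup V(F_i)$ and edge set $E(F_i)\cup\{v_iw_i\}$ (the $F$-constituents, with $v_i$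 the $F$-connection of $G_i$). Let $T$ be a tree with vertex set $\{v_1,\dots,v_q\}$ (the quotient graph) and $T'$ a connected $r$-edge graph with $V(T') \cap \bigcup_i V(G_i) = \{v_q\}$ (the remainder graph). The graph $G$ with $V(G) = V(T')\cup\bigcup_i V(G_i)$ and $E(G) = E(T)\cup E(T')\cup \bigcup_i E(G_i)$ is an $(m,F)$-special graph; it is connected with $m$ edges. It is pure if $q \ge 1$ and the remainder graph has no edges (so $r=0$ and $m+1 = q(k+2)$); equivalently, a pure $(m,F)$-special graph consists of a tree $T$ on $q\ge 1$ vertices $v_1,\dots,v_q$, pairwise disjoint copies $F_1,\dots,F_q$ of $F$ disjoint from $V(T)$, and one edge $v_iw_i$ with $w_i\in V(F_i)$ for each $i$. *)

(* Defs.v *)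
(* Simple graphs: a finType of vertices with a symmetric,
   irreflexive adjacency relation (these properties are hypotheses of the theorem). *)
From mathcomp Require Import all_boot.
From mathcomp Require Import finfun.
Set Implicit Arguments. Unset Strict Implicit. Unset Printing Implicit Defensive.

Section Graphs.
Variable T : finType.
Variable e : rel T.

Definition edges : {set {set T}} :=
  [set s : {set T} | [exists x, exists y, (s == [set x; y]) && e x y]].

Definition nedges : nat := #|edges|.

Definition connected_graph : Prop := forall x y : T, connect e x y.

Definition closed_nbhd (D : {set T}) : {set T} :=
  [set x | [exists y in D, (y == x) || e y x]].

Definition has_copy_outside (U : finType) (eF : rel U) (X : {set T}) : bool :=
  [exists f : {ffun U -> T}, [&& injectiveb f, [forall u, f u \notin X] &
    [forall u, forall u', eF u u' ==> e (f u) (f u')]]].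

Definition isolating (U : finType) (eF : rel U) (D : {set T}) : bool :=
  ~~ has_copy_outside eF (closed_nbhd D).

(* iota(G,F): minimum size of an F-isolating set (V(G) itself is always
   F-isolating when F has a vertex, so the default #|T| is never strictly used) *)
Definition iota_num (U : finType) (eF : rel U) : nat :=
  \big[minn/#|T|]_(D : {set T} | isolating eF D) #|D|.
End Graphs.

Definition has_dominating_vertex (U : finType) (eF : rel U) : Prop :=
  exists x : U, forall y, y != x -> eF x y.

Definition copy_of_F_plus_edge (U : finType) (eF : rel U) (T : finType) (e : rel T) : Prop :=
  exists (a b : U), a != b /\ ~~ eF a b /\
    exists f : U -> T, bijective f /\
      forall x y, e (f x) (f y) = [|| eF x y, (x == a) && (y == b) | (x == b) && (y == a)].

(* G is a pure (m,F)-special graph: V(G) is partitioned into vertices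
   v_1..v_q (q >= 1) and copies F_1..F_q of F (phi i embeds F onto F_i),
   the edges among the v_i form a tree, the edges inside F_i are exactly those of
   the copy, the only other edges are v_i w_i, and m + 1 = q (k + 2). *)
Definition pure_special (m : nat) (U : finType) (eF : rel U) (T : finType) (e : rel T) : Prop :=
  exists q : nat, 0 < q /\ m.+1 = q * (nedges eF).+2 /\
  exists (v : 'I_q -> T) (phi : 'I_q -> U -> T) (w : 'I_q -> U),
    injective v /\
    (forall i, injective (phi i)) /\
    (forall i j x, v i <> phi j x) /\
    (forall i j x y, phi i x = phi j y -> i = j) /\
    (forall t, (exists i, t = v i) \/ (exists i x, t = phi i x)) /\
    ((forall i j, connect [rel a b : 'I_q | e (v a) (v b)] i j) /\
     nedges [rel a b : 'I_q | e (v a) (v b)] = q.-1) /\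
    (forall i j x, e (v i) (phi j x) = (i == j) && (x == w j)) /\
    (forall i j x, e (phi j x) (v i) = (i == j) && (x == w j)) /\
    (forall i j x y, e (phi i x) (phi j y) = (i == j) && eF x y).

(* Main.v *)
(* A vertex of F that dominates F makes every copy of F lie inside the closed
   neighbourhood of its centre.  Write def(S) = e(S) + 1 - (k + 2) iota(S).  By induction on
   |S|, a connected S has def(S) >= 1 unless it is a copy of F (def = -1), a copy of F + e or
   a pure special graph (def = 0).

   If some vertex x cuts off a copy C of F or F + e as a component of S - x, dominate C with x
   and treat the other components of S - x inductively: nothing is lost only if C hangs on x by
   one edge and every other component is pure special and attached to x by one edge at a
   connection vertex, and then S is pure special.

   Otherwise, after deletion of a set X, every component that is a copy of F or F + e is joined
   to X by at least two edges.  Deleting N[v] for a centre v of a copy then gains at least 1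
   for each component of S - N[v], unless that component is a copy of F or is pure special and
   hangs on one edge.  These cases reduce to a copy Q of F whose complement is connected; there
   the count fails only for a few small graphs, in which one or two well chosen vertices
   isolate: a copy of F using a single edge between two parts has a leaf at its end, which
   forces most of one part to be adjacent to one vertex, and this cannot happen for all choices
   when k >= 3. *)
Require Import Defs.
From mathcomp Require Import all_boot.
From mathcomp Require Import zify.
Set Implicit Arguments. Unset Strict Implicit. Unset Printing Implicit Defensive.

(* [lia] splits on every boolean hypothesis, so the memberships are cleared first. *)
Ltac nat_lia := repeat match goal with
  | H : is_true ?b |- _ => lazymatch b with leq _ _ => fail | _ => clear H end
  end; lia.

(** * Double counting of edges inside and between vertex sets *)

Section EdgeCounting.
Variables (T : finType) (e : rel T).
Hypotheses (e_sym : symmetric e) (e_irr : irreflexive e).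
Implicit Types (X Y Z S : {set T}) (x y z : T).

Definition msize S := #|[set s in edges e | s \subset S]|.
(** For disjoint [X] and [Y] this is the number of edges between them; counting ordered pairs makes
    it additive in each argument. *)
Definition cross X Y := \sum_(x in X) \sum_(y in Y) (e x y : nat).

Lemma cross_sym X Y : cross X Y = cross Y X.
Proof.
rewrite /cross exchange_big /=; apply: eq_bigr => y _; apply: eq_bigr => x _.
by rewrite e_sym.
Qed.

Lemma set2_inj (x y a b : T) : [set x; y] = [set a; b] ->
  (x = a /\ y = b) \/ (x = b /\ y = a).
Proof.
move=> E.
have := set21 x y; rewrite E in_set2 => /orP[] /eqP xE;
have := set22 x y; rewrite E in_set2 => /orP[] /eqP yE; subst; auto.
- have := set22 a b; rewrite -E !inE orbb => /eqP ->; auto.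
- have := set21 a b; rewrite -E !inE orbb => /eqP ->; auto.
Qed.

(** Handshake identity: grouping adjacent ordered pairs by their unordered pair gives classes of
    size exactly two, since there are no loops. It turns additivity of [cross] into formulas for
    [msize]. *)
Lemma cross_diag S : cross S S = 2 * msize S.
Proof.
have -> : cross S S = \sum_(p : T * T | [&& p.1 \in S, p.2 \in S & e p.1 p.2]) 1.
  rewrite /cross pair_big /= [LHS]big_mkcond [RHS]big_mkcond /=.
  by apply: eq_bigr => -[x y] _ /=; case: (x \in S); case: (y \in S); case: (e x y).
rewrite (partition_big (fun p : T * T => [set p.1; p.2])
  (fun s => (s \in edges e) && (s \subset S))) /=; last first.
  move=> [x y] /= /and3P[xS yS xy]; rewrite !inE; apply/andP; split.
    by apply/existsP; exists x; apply/existsP; exists y; rewrite eqxx xy.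
  by rewrite subUset !sub1set xS yS.
rewrite (eq_bigr (fun => 2)); last first.
  move=> s /andP[]; rewrite inE => /existsP[x /existsP[y /andP[/eqP -> xy]]].
  rewrite subUset !sub1set => /andP[xS yS].
  have nxy : x != y by apply: contraTneq xy => ->; rewrite e_irr.
  rewrite (eq_bigl (fun p => p \in [set (x, y); (y, x)])).
    by rewrite sum1_card cards2 xpair_eqE (negbTE nxy).
  move=> [a b] /=; rewrite !inE !xpair_eqE; apply/andP/orP.
    by case=> _ /eqP /set2_inj [] [-> ->]; rewrite !eqxx; auto.
  case=> /andP[/eqP -> /eqP ->]; first by rewrite xS yS xy.
  by rewrite yS xS e_sym xy setUC.
by rewrite sum_nat_const mulnC; congr (_ * _); apply: eq_card => s; rewrite [in RHS]inE unfold_in.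
Qed.

Lemma nedges_msize : nedges e = msize setT.
Proof. by apply: eq_card => s; rewrite !inE subsetT andbT. Qed.

Lemma crossUl X Y Z : [disjoint X & Y] ->
  cross (X :|: Y) Z = cross X Z + cross Y Z.
Proof.
move=> dXY; rewrite /cross -bigU //=.
by apply: eq_bigl => x; rewrite !inE.
Qed.

Lemma crossUr X Y Z : [disjoint X & Y] ->
  cross Z (X :|: Y) = cross Z X + cross Z Y.
Proof. by move=> dXY; rewrite cross_sym crossUl // !(cross_sym Z). Qed.

Lemma msizeU X Y : [disjoint X & Y] ->
  msize (X :|: Y) = msize X + msize Y + cross X Y.
Proof.
move=> dXY; have := cross_diag (X :|: Y).
rewrite crossUl // !crossUr // !cross_diag (cross_sym Y X); lia.
Qed.

Lemma msizeS X Y : X \subset Y -> msize X <= msize Y.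
Proof.
move=> sXY; apply: subset_leq_card; apply/subsetP => s; rewrite !inE.
by case/andP=> -> /subset_trans ->.
Qed.

Lemma disjointD X S : [disjoint X & S :\: X].
Proof. by rewrite -setI_eq0 setDE setICA setICr setI0. Qed.

Lemma msizeD X S : X \subset S ->
  msize S = msize X + msize (S :\: X) + cross X (S :\: X).
Proof.
by move=> sXS; rewrite -msizeU ?disjointD // -{1}(setID S X) (setIidPr sXS).
Qed.

Lemma cross1 x Y : cross [set x] Y = #|[set y in Y | e x y]|.
Proof.
rewrite /cross big_set1 -sum1_card [LHS]big_mkcond [RHS]big_mkcond /=.
by apply: eq_bigr => y _; rewrite inE; case: (y \in Y); case: (e x y).
Qed.

Lemma crossS X X' Y Y' : X \subset X' -> Y \subset Y' -> cross X Y <= cross X' Y'.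
Proof.
move=> sX sY.
rewrite -(setIidPr sX) -(setIidPr sY) -{2}(setID X' X) -{2}(setID Y' Y).
have d A B : [disjoint A :&: B & A :\: B].
  by rewrite -setI_eq0 setDE setIACA setICr setI0.
rewrite crossUl ?d // !crossUr ?d //; lia.
Qed.

Lemma cross_gt0P X Y :
  reflect (exists x y, [/\ x \in X, y \in Y & e x y]) (0 < cross X Y).
Proof.
apply: (iffP idP) => [|[x [y [xX yY xy]]]]; last first.
  by rewrite /cross (bigD1 x) //= (bigD1 y) //= xy.
rewrite lt0n /cross => /eqP cN0; case: (boolP [exists x in X, exists y in Y, e x y]).
  by case/exists_inP=> x xX /exists_inP[y yY xy]; exists x, y.
move=> N; case: cN0.
rewrite big1 // => x xX; rewrite big1 // => y yY; case xy: (e x y) => //.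
by case/exists_inP: N; exists x => //; apply/exists_inP; exists y.
Qed.

Lemma cross0 X Y :
  (forall x y, x \in X -> y \in Y -> ~~ e x y) -> cross X Y = 0.
Proof.
move=> H; apply/eqP; rewrite -leqn0 leqNgt; apply/cross_gt0P => -[x [y [xX yY]]].
by apply/negP/H.
Qed.

Lemma cross0_adj X Y x y :
  cross X Y = 0 -> x \in X -> y \in Y -> e x y = false.
Proof.
move=> c0 xX yY; apply/negP => xy.
by have : 0 < cross X Y by [apply/cross_gt0P; exists x, y]; rewrite c0.
Qed.

Lemma cross_gt1 X Y x y x' y' : x \in X -> y \in Y -> e x y ->
  x' \in X -> y' \in Y -> e x' y' -> (x, y) != (x', y') -> 1 < cross X Y.
Proof.
move=> xX yY xy x'X y'Y x'y'; rewrite xpair_eqE.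
case: (eqVneq x x') => [E|nx] /= ny.
  apply: leq_trans (crossS (_ : [set x] \subset X) (subxx Y)); rewrite ?sub1set //.
  rewrite cross1 (cardsD1 y) (cardsD1 y') !inE yY y'Y xy eq_sym ny /= E x'y'; lia.
have dx : x' \in X :\: [set x] by rewrite !inE eq_sym nx.
have -> : X = [set x] :|: X :\: [set x].
  by apply/setP => z; rewrite !inE; case: eqP => // ->.
rewrite crossUl ?disjointD //.
have : 0 < cross [set x] Y by apply/cross_gt0P; exists x, y; rewrite !inE.
have : 0 < cross (X :\: [set x]) Y by apply/cross_gt0P; exists x', y'.
lia.
Qed.

Lemma cross_le1 X Y x y x' y' : cross X Y <= 1 -> x \in X -> y \in Y -> e x y ->
  x' \in X -> y' \in Y -> e x' y' -> x = x' /\ y = y'.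
Proof.
move=> c xX yY xy x'X y'Y x'y'; apply/pair_equal_spec/eqP/negP => /negP N.
by have := cross_gt1 xX yY xy x'X y'Y x'y' N; lia.
Qed.

Lemma msize1 x : msize [set x] = 0.
Proof.
have := cross_diag [set x]; rewrite /cross !big_set1 e_irr; lia.
Qed.

Lemma msizeD1 x S : x \in S ->
  msize S = msize (S :\ x) + cross [set x] (S :\ x).
Proof. by move=> xS; rewrite (@msizeD [set x]) ?sub1set // msize1. Qed.

Lemma msize_le S : 2 * msize S <= #|S| * #|S|.-1.
Proof.
rewrite -cross_diag -sum_nat_const leq_sum // => x xS.
rewrite (eq_bigr (fun y => if y \in S :\ x then (e x y : nat) else 0)); last first.
  by move=> y yS; rewrite !inE yS andbT; case: eqVneq => //= ->; rewrite e_irr.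
rewrite -(leq_add2l 1) -big_mkcondr /=.
apply: (@leq_trans (1 + \sum_(y in S :\ x) 1)).
  rewrite leq_add2l (eq_bigl (fun y => y \in S :\ x)) ?leq_sum // => [y _|y].
    exact: leq_b1.
  by rewrite !inE; case: (y \in S); rewrite ?andbF.
by rewrite sum1_card (cardsD1 x S) xS.
Qed.

End EdgeCounting.

(** * Copies of F and isolation *)

Section Isolation.
Variables (U : finType) (eF : rel U).
Hypotheses (eF_sym : symmetric eF) (eF_irr : irreflexive eF).
Hypothesis (eF_dom : has_dominating_vertex eF).
Hypothesis (eF_size : 3 <= nedges eF).
Variables (T : finType) (e : rel T).
Hypotheses (e_sym : symmetric e) (e_irr : irreflexive e).
Implicit Types (A B C D Q R S W X Y Z : {set T}) (x y z : T).

Let k := nedges eF.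
Let l := #|U|.
Local Notation m := (msize e).
Local Notation cr := (cross e).
Local Notation N x := (closed_nbhd e [set x]).

(** [has_copy_outside] takes the set to be avoided, hence the complement. Copies need not be
    induced. *)
Definition hasF Z := has_copy_outside e eF (~: Z).

Lemma hasFP Z : reflect (exists f : U -> T, [/\ injective f, forall u, f u \in Z &
  forall u u', eF u u' -> e (f u) (f u')]) (hasF Z).
Proof.
apply: (iffP existsP) => [[f /and3P[/injectiveP fI /forallP fZ /forallP fe]]|].
  exists f; split=> // [u|u u' uu']; first by have := fZ u; rewrite inE negbK.
  exact: (implyP (forallP (fe u) u')).
case=> f [fI fZ fe]; exists [ffun u => f u]; apply/and3P; split.
- by apply/injectiveP => u u'; rewrite !ffunE => /fI.
- by apply/forallP => u; rewrite ffunE inE negbK.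
- by apply/forallP => u; apply/forallP => u'; rewrite !ffunE; apply/implyP/fe.
Qed.

Lemma hasFS X Y : X \subset Y -> hasF X -> hasF Y.
Proof.
move=> /subsetP sXY /hasFP[f [fI fX fe]]; apply/hasFP; exists f; split=> // u.
exact/sXY/fX.
Qed.

Lemma cross_image (f : U -> T) : injective f ->
  cr (f @: setT) (f @: setT) = \sum_u \sum_u' (e (f u) (f u') : nat).
Proof.
move=> fI; have fI' : {in [set: U] &, injective f} by move=> u u' _ _ /fI.
rewrite /cross big_imset //=; apply: eq_big => [u|u _]; rewrite ?inE // big_imset //=.
by apply: eq_bigl => u'; rewrite inE.
Qed.

Lemma sum_eF : \sum_u \sum_u' (eF u u' : nat) = 2 * k.
Proof.
rewrite /k nedges_msize -cross_diag // /cross.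
apply: eq_big => [u|u _]; rewrite ?inE //.
by apply: eq_bigl => u'; rewrite inE.
Qed.

(** The centre [z] is the image of a dominating vertex of [F]. *)
Lemma hasF_star Z : hasF Z -> exists W z, [/\ W \subset Z, z \in W, #|W| = l, hasF W &
  forall y, y \in W -> y != z -> e z y].
Proof.
case/hasFP=> f [fI fZ fe]; have [c cP] := eF_dom.
exists (f @: setT), (f c); split.
- by apply/subsetP => _ /imsetP[u _ ->].
- by apply: imset_f; rewrite inE.
- by rewrite card_imset // cardsT.
- by apply/hasFP; exists f; split=> // u; apply: imset_f; rewrite inE.
- move=> _ /imsetP[u _ ->]; rewrite (inj_eq fI) => nu; exact/fe/cP.
Qed.

Lemma hasF_msize Z : hasF Z -> k <= m Z.
Proof.
case/hasFP=> f [fI fZ fe]; have fTZ : f @: setT \subset Z.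
  by apply/subsetP => _ /imsetP[u _ ->].
apply: leq_trans (msizeS e fTZ).
rewrite -(@leq_pmul2l 2) // -cross_diag // cross_image // -sum_eF.
apply: leq_sum => u _; apply: leq_sum => u' _.
by case E: (eF u u') => //; rewrite fe.
Qed.

Lemma hasF_card Z : hasF Z -> l <= #|Z|.
Proof. by case/hasF_star=> W [z [/subset_leq_card sW _ <- _ _]]. Qed.

Lemma order_F_ge3 : 3 <= l.
Proof.
have := msize_le eF_sym eF_irr setT; rewrite -nedges_msize cardsT -/l -/k.
by move: eF_size; rewrite -/k; case: l => [|[|[|]]] //=; lia.
Qed.

(** Every vertex of a copy equals or is adjacent to the image of the dominating vertex, so the whole
    copy lies on the side of that image. *)
Lemma hasFU X Y : cr X Y = 0 -> hasF (X :|: Y) -> hasF X \/ hasF Y.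
Proof.
move=> cXY /hasFP[f [fI fXY fe]]; have [c cP] := eF_dom.
have H (P Q : {set T}) : (forall x y, x \in P -> y \in Q -> ~~ e x y) ->
    (forall u, f u \in P :|: Q) -> f c \in P -> hasF P.
  move=> cPQ fPQ fc; apply/hasFP; exists f; split=> // u.
  have := fPQ u; rewrite inE => /orP[//|fu].
  by case: (eqVneq u c) => [->//|/cP/fe]; rewrite (negbTE (cPQ _ _ fc fu)).
have := fXY c; rewrite inE => /orP[fc|fc]; [left; apply: (H X Y) => //|].
  by move=> x y xX yY; rewrite (cross0_adj cXY).
right; apply: (H Y X) => // [x y xY yX|u]; first by rewrite e_sym (cross0_adj cXY).
by rewrite setUC.
Qed.

(** * Closed neighbourhoods and upper bounds for isolation *)

Lemma in_nbhd D x : x \in closed_nbhd e D = [exists y in D, (y == x) || e y x].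
Proof. by rewrite inE. Qed.

Lemma in_nbhd1 x y : (y \in N x) = (y == x) || e x y.
Proof.
rewrite in_nbhd; apply/exists_inP/idP => [[z]|xy].
  by rewrite inE => /eqP ->; rewrite eq_sym.
by exists x; rewrite ?inE // eq_sym.
Qed.

Lemma nbhdS D D' : D \subset D' -> closed_nbhd e D \subset closed_nbhd e D'.
Proof.
move=> /subsetP sD; apply/subsetP => x; rewrite !in_nbhd => /exists_inP[y yD xy].
by apply/exists_inP; exists y => //; apply: sD.
Qed.

Lemma nbhdU D D' : closed_nbhd e (D :|: D') = closed_nbhd e D :|: closed_nbhd e D'.
Proof.
apply/eqP; rewrite eqEsubset; apply/andP; split; last first.
  by rewrite subUset !nbhdS ?subsetUl ?subsetUr.
apply/subsetP => x; rewrite in_setU !in_nbhd => /exists_inP[y]; rewrite inE.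
by case/orP=> yD xy; apply/orP; [left|right]; apply/exists_inP; exists y.
Qed.

Lemma sub_nbhd D x : x \in D -> N x \subset closed_nbhd e D.
Proof. by move=> xD; apply: nbhdS; rewrite sub1set. Qed.

(* [iota(G[Z], F) * (k + 2) <= n]; allowing [D] to leave [Z] does no harm. *)
Definition bounded Z n := 
  exists2 D : {set T}, #|D| * (k + 2) <= n & ~~ hasF (Z :\: closed_nbhd e D).

Lemma bounded_le Z n n' : n <= n' -> bounded Z n -> bounded Z n'.
Proof. by move=> nn' [D Dn hD]; exists D => //; apply: leq_trans nn'. Qed.

Lemma boundedS Z Z' n : Z \subset Z' -> bounded Z' n -> bounded Z n.
Proof.
move=> sZ [D Dn hD]; exists D => //; apply: contra hD; apply: hasFS; exact: setSD.
Qed.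

Lemma bounded0 Z n : ~~ hasF Z -> bounded Z n.
Proof.
move=> hZ; exists set0; first by rewrite cards0.
by apply: contra hZ; apply: hasFS; rewrite subsetDl.
Qed.

Lemma bounded_card Z n : #|Z| < l -> bounded Z n.
Proof. by move=> Zl; apply: bounded0; apply/negP => /hasF_card; lia. Qed.

Lemma bounded1 Z n x : bounded (Z :\: N x) n -> bounded Z (n + (k + 2)).
Proof.
case=> D Dn hD; exists (x |: D).
  apply: leq_trans (_ : (1 + #|D|) * (k + 2) <= _); last by lia.
  by rewrite leq_mul2r cardsU1 leq_add2r leq_b1 orbT.
by rewrite nbhdU -setDDl.
Qed.

Lemma boundedU X Y n n' : cr X Y = 0 -> bounded X n -> bounded Y n' ->
  bounded (X :|: Y) (n + n').
Proof.
move=> cXY [D Dn hD] [D' Dn' hD']; exists (D :|: D').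
  apply: leq_trans (_ : (#|D| + #|D'|) * (k + 2) <= _); last by lia.
  by rewrite leq_mul2r cardsU leq_subr orbT.
apply/negP; rewrite nbhdU setDUl => /hasFU[].
- apply/eqP; rewrite -leqn0 -cXY; apply: crossS => //; exact: subsetDl.
- by apply/negP; apply: contra hD; apply: hasFS; rewrite setDS // subsetUl.
- by apply/negP; apply: contra hD'; apply: hasFS; rewrite setDS // subsetUr.
Qed.

(* Connectedness through cuts, for which [conn set0] holds vacuously. *)
Definition conn S := forall A, A \subset S -> A != set0 -> A != S -> 0 < cr A (S :\: A).

Definition component C Y := [/\ C \subset Y, C != set0, conn C & cr C (Y :\: C) = 0].

(** Among the nonempty subsets of [Y] that send no edge to the rest of [Y], a smallest one is
    connected: a cut of it without edges would yield a smaller such subset. *)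
Lemma component_exists Y : Y != set0 -> exists C, component C Y.
Proof.
move=> Y0; pose P C := [&& C \subset Y, C != set0 & cr C (Y :\: C) == 0].
have PY : P Y.
  by rewrite /P subxx Y0; apply/eqP/cross0 => x y _; rewrite setDv inE.
case: (arg_minnP (fun C => #|C|) PY) => C /and3P[CY C0 /eqP cC] minC.
exists C; split=> // A AC A0 nAC; rewrite lt0n; apply/negP => /eqP cA.
have := minC A; rewrite /P (subset_trans AC CY) A0 /=.
have -> : cr A (Y :\: A) = 0.
  have -> : Y :\: A = (C :\: A) :|: (Y :\: C).
    apply/setP => x; rewrite !inE; have := subsetP AC x; have := subsetP CY x.
    by case: (x \in A); case: (x \in C); case: (x \in Y) => // H1 H2;
       rewrite ?H1 ?H2 //; case: H1; case: H2.
  rewrite crossUr // ?cA ?add0n; last first.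
    by rewrite -setI_eq0; apply/eqP/setP => x; rewrite !inE; case: (x \in C); rewrite ?andbF.
  by apply/eqP; rewrite -leqn0 -cC; apply: crossS.
move=> /(_ isT); rewrite leqNgt proper_card // properEneq nAC //.
Qed.

Lemma component_trans Y C C' : component C Y -> component C' (Y :\: C) -> component C' Y.
Proof.
move=> [CY C0 cC zC] [C'Y C'0 cC' zC']; split=> //.
  by apply: subset_trans C'Y _; apply: subsetDl.
apply: cross0 => x y xC'; rewrite inE => /andP[yC' yY].
case: (boolP (y \in C)) => yC.
  by rewrite e_sym (cross0_adj zC yC (subsetP C'Y x xC')).
by rewrite (cross0_adj zC' xC') // !inE yC yC'.
Qed.

(** A copy of [F] spans [C] and there are [j] further edges. Hence [j = 0] describes a copy of [F],
    and [j = 1] a copy of some [F + e]. *)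
Definition Fplus j C := [&& #|C| == l, m C == k + j & hasF C].

(** The trace on [Y] of a copy of [F] that is centred at [z] and has only a leaf outside [Y]. *)
Definition full Y z := [/\ z \in Y, #|Y|.+1 = l, k <= (m Y).+1 &
  forall y, y \in Y -> y != z -> e z y].

(** If [l = 3], then [Y] has two vertices and at most one edge, which forces [k <= 2]. *)
Lemma full_l_ge4 Y z : full Y z -> 4 <= l.
Proof.
case=> zY Yl kY _; have := msize_le e_sym e_irr Y; have := order_F_ge3; rewrite leq_eqVlt.
case/orP=> // /eqP l3; move: eF_size; rewrite -/k; have -> : #|Y| = 2 by nat_lia.
nat_lia.
Qed.

Lemma full_deg Y z : full Y z -> l <= (cr [set z] (Y :\ z)).+2.
Proof.
case=> zY <- _ zP; rewrite (cardsD1 z) zY cross1 add1n !ltnS.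
apply: subset_leq_card; apply/subsetP => y; rewrite !inE => /andP[nyz yY].
by rewrite nyz yY zP.
Qed.

Definition matched Y Y' := forall x, x \in Y -> cr [set x] Y' <= 1.

(** The centre [z] has at most one neighbour in [Y'], so the copy has at most one vertex there. As
    [Y] is too small to hold the copy, [W] consists of all of [Y] and one vertex [b], and [b] is a
    leaf because it has at most one neighbour in [Y]. *)
Lemma copy_across Y Y' W z : [disjoint Y & Y'] -> #|Y| < l -> matched Y Y' -> matched Y' Y ->
  W \subset Y :|: Y' -> #|W| = l -> k <= m W -> (forall y, y \in W -> y != z -> e z y) ->
  z \in Y -> exists b, [/\ b \in Y', e z b & full Y z].
Proof.
move=> dYY' Yl mYY' mY'Y sW Wl kW zW zY.
have WE : W = (W :&: Y) :|: (W :&: Y') by rewrite -setIUr (setIidPl sW).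
have dW : [disjoint W :&: Y & W :&: Y'].
  by rewrite -setI_eq0 setIACA setIid; move/eqP: (disjoint_setI0 dYY') => /eqP ->; rewrite setI0.
have cW : #|W :&: Y| + #|W :&: Y'| = l.
  by rewrite -Wl {3}WE cardsU (disjoint_setI0 dW) cards0 subn0.
have cWY : #|W :&: Y| <= #|Y| by rewrite subset_leq_card // subsetIr.
have cWY' : #|W :&: Y'| <= 1.
  apply: leq_trans (mYY' z zY); rewrite cross1; apply: subset_leq_card.
  apply/subsetP => y; rewrite !inE => /andP[yW yY']; rewrite yY' zW //.
  by apply: contraTneq zY => <-; rewrite (disjointFl dYY').
have /cards1P[b bE] : #|W :&: Y'| == 1 by apply/eqP; nat_lia.
have WYE : W :&: Y = Y by apply/eqP; rewrite eqEcard subsetIr; nat_lia.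
have /setIP[bW bY'] : b \in W :&: Y' by rewrite bE inE.
have nbz : b != z by apply: contraTneq zY => <-; rewrite (disjointFl dYY').
exists b; split=> //; first exact: zW; split=> //; first by nat_lia.
  have := kW; rewrite WE msizeU // WYE bE msize1 // cross_sym //.
  by have := mY'Y b bY'; nat_lia.
by move=> y yY nyz; apply: zW => //; rewrite WE WYE inE yY.
Qed.

Lemma hasF_across Y Y' : [disjoint Y & Y'] -> #|Y| < l -> #|Y'| < l ->
  matched Y Y' -> matched Y' Y -> hasF (Y :|: Y') ->
  exists y y', [/\ y \in Y, y' \in Y', e y y' & full Y y \/ full Y' y'].
Proof.
move=> dYY' Yl Y'l mYY' mY'Y /hasF_star[W [z [sW zW Wl /hasF_msize kW zP]]].
move: (subsetP sW z zW); rewrite inE => /orP[] zY.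
  have [b [bY' zb fY]] := copy_across dYY' Yl mYY' mY'Y sW Wl kW zP zY.
  by exists z, b; split=> //; left.
rewrite setUC in sW; rewrite disjoint_sym in dYY'.
have [b [bY zb fY']] := copy_across dYY' Y'l mY'Y mYY' sW Wl kW zP zY.
by exists b, z; split; rewrite // 1?e_sym //; right.
Qed.

(* The first hypothesis makes [b] adjacent to almost all of [Q], the second makes [b] a leaf. *)
Lemma full_full Q a b c : Fplus 0 Q -> b \in Q ->
  full (Q :\ a) b -> full (Q :\ b) c -> False.
Proof.
move=> /and3P[_ /eqP mQ _] bQ fa fb; have := full_deg fa; have := full_l_ge4 fa.
case: fb => _ _ kb _; have := msizeD1 e_sym e_irr bQ; rewrite mQ.
suff : cr [set b] ((Q :\ a) :\ b) <= cr [set b] (Q :\ b) by nat_lia.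
by rewrite crossS // setDDl setUC -setDDl subsetDl.
Qed.

Lemma Fplus_center j C : Fplus j C -> exists2 u, u \in C & C \subset N u.
Proof.
case/and3P=> /eqP Cl _ /hasF_star[W [u [sW uW Wl _ uP]]].
have WC : W = C by apply/eqP; rewrite eqEcard sW Cl Wl leqnn.
exists u; first by rewrite -WC.
apply/subsetP => y; rewrite -WC in_nbhd1 => yW.
by case: eqVneq => //= nyu; apply: uP.
Qed.

Lemma Fplus_nbr j C x : Fplus j C -> x \in C -> exists2 y, y \in C & e x y.
Proof.
move=> FC xC; have [u uC /subsetP uP] := Fplus_center FC.
case: (eqVneq x u) => [->|nxu].
  have /card_gt0P[y] : 0 < #|C :\ u|.
    case/and3P: FC => /eqP Cl _ _; have := cardsD1 u C; rewrite uC Cl.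
    by have := order_F_ge3; nat_lia.
  rewrite !inE => /andP[nyu yC]; exists y => //.
  by have := uP y yC; rewrite in_nbhd1 (negbTE nyu).
exists u => //; rewrite e_sym; by have := uP x xC; rewrite in_nbhd1 (negbTE nxu).
Qed.

Lemma card_nbhd2 C x y : x \in C -> y \in C -> e x y -> #|C :\: N x| + 2 <= #|C|.
Proof.
move=> xC yC xy; have nyx : y != x by apply: contraTneq xy => ->; rewrite e_irr.
have /subset_leq_card : C :\: N x \subset C :\ x :\ y.
  apply/subsetP => z; rewrite in_setD in_nbhd1 !inE negb_or => /andP[/andP[nzx nxz] zC].
  by rewrite nzx zC !andbT; apply: contraNneq nxz => ->.
by have := cardsD1 x C; have := cardsD1 y (C :\ x); rewrite !inE xC yC nyx /=; nat_lia.
Qed.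

Lemma Fplus_nbhd j C x : Fplus j C -> x \in C -> #|C :\: N x| + 2 <= l.
Proof.
move=> FC xC; have [y yC xy] := Fplus_nbr FC xC.
by case/and3P: FC => /eqP <- _ _; apply: card_nbhd2 xy.
Qed.

Lemma conn_star S v : S \subset N v -> v \in S -> conn S.
Proof.
move=> /subsetP Sv vS A AS A0 nAS; apply/cross_gt0P.
case: (boolP (v \in A)) => vA.
  have /set0Pn[y] : S :\: A != set0.
    by rewrite setD_eq0; apply: contra nAS => SA; rewrite eqEsubset AS.
  rewrite !inE => /andP[yA yS]; exists v, y; split=> //; first by rewrite !inE yA.
  by have := Sv y yS; rewrite in_nbhd1; case: eqVneq yA => //= ->; rewrite vA.
case/set0Pn: A0 => y yA; exists y, v; split=> //; first by rewrite !inE vA.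
have := Sv y (subsetP AS y yA); rewrite in_nbhd1 e_sym.
by case: eqVneq => // yv; rewrite -yv yA in vA.
Qed.

Lemma Fplus_conn j C : Fplus j C -> conn C.
Proof. by case/Fplus_center=> u uC uP; apply: conn_star uP uC. Qed.

(** [Q] sends edges only to [X]. In a cut of [S :\: Q] without edges, the connected set [X] lies on
    one side; the other side would then send no edge to the rest of [S]. *)
Lemma conn_setD X S Q : conn S -> X \subset S -> X != set0 -> conn X ->
  component Q (S :\: X) -> conn (S :\: Q).
Proof.
move=> cS XS X0 cX [QSX Q0 _ zQ].
have XQ : X \subset S :\: Q.
  apply/subsetP => x xX; rewrite inE (subsetP XS) // andbT; apply/negP.
  by move/(subsetP QSX); rewrite inE xX.
have H B : B \subset S :\: Q -> B != set0 -> B :&: X = set0 ->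
    cr B ((S :\: Q) :\: B) = 0 -> False.
  move=> BSQ B0 BX zB.
  have BS : B \subset S by apply: subset_trans BSQ (subsetDl _ _).
  suff : 0 < cr B (S :\: B).
    case/cross_gt0P=> x [y [xB]]; rewrite inE => /andP[yB yS xy].
    case: (boolP (y \in Q)) => yQ; last first.
      by rewrite (cross0_adj zB xB) // !inE yB yQ in xy.
    rewrite e_sym (cross0_adj zQ yQ) // in xy.
    have := subsetP BSQ x xB; rewrite !inE => /andP[-> ->]; rewrite andbT.
    by apply/negP => xX; move/setP: BX => /(_ x); rewrite !inE xB xX.
  apply: cS => //; case/set0Pn: X0 => x xX; apply: contraTneq xX => BE.
  by apply/negP => xX; move/setP: BX => /(_ x); rewrite !inE xX BE (subsetP XS).
move=> A ASQ A0 nA; rewrite lt0n; apply/negP => /eqP zA.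
case: (boolP (A :&: X == set0)) => [/eqP AX|AX]; first exact: (H A).
have XA : X \subset A.
  apply/negPn/negP => nXA; have := cX (A :&: X) (subsetIr _ _) AX.
  move=> /(_ _)/cross_gt0P[].
    by apply: contra nXA => /eqP <-; apply: subsetIl.
  move=> x [y []]; rewrite !inE => /andP[xA xX] /andP[]; rewrite negb_and.
  case/orP=> [yA yX|/negP//]; apply/negP; rewrite (cross0_adj zA) // inE yA.
  exact: (subsetP XQ).
apply: (H ((S :\: Q) :\: A)).
- exact: subsetDl.
- by rewrite setD_eq0; apply: contra nA => SA; rewrite eqEsubset ASQ.
- apply/setP => x; rewrite !inE; apply/negP => /andP[/andP[/negP xA _]] /(subsetP XA)//.
- apply: cross0 => x y xSQ; rewrite setDDr setDv set0U inE => /andP[_ yA].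
  by rewrite e_sym (cross0_adj zA).
Qed.

(** * Pure special graphs inside the host graph *)

Definition fiber S R (rho : T -> T) r := [set s in S :\: R | rho s == r].

(* [R] is the set of connection vertices and [rho] sends a vertex to the connection
   vertex of its constituent, so that [r |: fiber S R rho r] is a constituent.
   That [R] induces a tree follows from connectedness and the edge count in [pure]. *)
Record pure_on S R (rho : T -> T) : Prop := PureOn {
  pure_sub : R \subset S;
  pure_rho : forall s, s \in S -> rho s \in R;
  pure_fix : forall r, r \in R -> rho r = r;
  pure_edge : forall s t, s \in S -> t \in S -> e s t ->
    rho s = rho t \/ s \in R /\ t \in R;
  pure_fiber : forall r, r \in R -> Fplus 0 (fiber S R rho r);
  pure_attach : forall r, r \in R -> exists2 w, w \in fiber S R rho r &
    forall s, s \in fiber S R rho r -> e r s = (s == w) }.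

Definition pure S := exists R rho, pure_on S R rho /\ #|R| * (k + 2) = (m S).+1.

Section PureOn.
Variables (S R : {set T}) (rho : T -> T).
Hypothesis P : pure_on S R rho.
Local Notation fib := (fiber S R rho).

Lemma in_fiber r s : (s \in fib r) = [&& s \notin R, s \in S & rho s == r].
Proof. by rewrite !inE andbA. Qed.

Lemma fiber_sub r : fib r \subset S.
Proof. by apply/subsetP => s; rewrite in_fiber => /and3P[]. Qed.

Lemma fiber_edge r s t : s \in fib r -> t \in S -> e s t -> t = r \/ t \in fib r.
Proof.
rewrite in_fiber => /and3P[sR sS /eqP <-] tS st.
have [E|[sR' _]] := pure_edge P sS tS st; last by rewrite sR' in sR.
case: (boolP (t \in R)) => tR; [left|right]; first by rewrite E (pure_fix P).
by rewrite in_fiber tR tS E eqxx.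
Qed.

Lemma fiber_cross r : r \in R -> cr [set r] (fib r) = 1.
Proof.
case/(pure_attach P)=> w wF wP; rewrite cross1; apply/eqP/cards1P; exists w.
apply/setP => s; rewrite !inE -!in_setD; apply/andP/eqP => [[sF rs]|->].
  by apply/eqP; rewrite -wP // inE.
by move: (wF); rewrite inE => ->; rewrite wP.
Qed.

(** Edges from the centre that avoid [R] stay in one fibre, so the copy lies in that fibre; both
    have [l] vertices, so they coincide. *)
Lemma hasF_fiber Z : Z \subset S -> [disjoint Z & R] -> hasF Z ->
  exists2 r, r \in R & fib r \subset Z.
Proof.
move=> ZS ZR /hasF_star[W [z [/subsetP WZ zW Wl _ zP]]].
have ZnR y : y \in W -> y \notin R by move=> /WZ yZ; rewrite (disjointFr ZR).
have zS : z \in S by apply: (subsetP ZS); apply: WZ.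
exists (rho z); first exact: (pure_rho P).
suff -> : fib (rho z) = W by apply/subsetP.
have /and3P[/eqP Fl _ _] := pure_fiber P (pure_rho P zS).
apply/esym/eqP; rewrite eqEcard Fl Wl leqnn andbT; apply/subsetP => y yW.
have yS : y \in S by apply: (subsetP ZS); apply: WZ.
rewrite in_fiber ZnR // yS /=; case: (eqVneq y z) => [->//|nyz].
have [->//|[]] := pure_edge P zS yS (zP y yW nyz).
by rewrite (negbTE (ZnR z zW)).
Qed.

(** A surviving copy would be a whole fibre, but its attaching vertex [w] is dominated by the
    connection vertex. *)
Lemma pure_isolating : ~~ hasF (S :\: closed_nbhd e R).
Proof.
apply/negP => /hasF_fiber[]; first exact: subsetDl.
  apply/pred0P => x /=; apply/negP => /andP[]; rewrite inE in_nbhd => /andP[xN _] xR.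
  by case/negP: xN; apply/exists_inP; exists x; rewrite ?eqxx.
move=> r rR; have [w wF wP] := pure_attach P rR.
move=> /subsetP/(_ w wF); rewrite inE in_nbhd => /andP[/negP wN _].
by case: wN; apply/exists_inP; exists r => //; rewrite wP // eqxx orbT.
Qed.

(** The constituent of [r] is not all of [S], and an edge that leaves it must join two connection
    vertices. *)
Lemma pure_link r : conn S -> r \in R -> R != [set r] ->
  exists r', [/\ r' \in R, r' != r & e r r'].
Proof.
move=> cS rR nR; have rS := subsetP (pure_sub P) r rR.
have /set0Pn[r' ] : R :\ r != set0.
  by apply: contra nR => /eqP R0; rewrite -(setD1K rR) R0 setU0.
rewrite !inE => /andP[nr' r'R].
have := cS (r |: fib r); rewrite subUset sub1set rS fiber_sub => /(_ isT).
case/(_ _ _)/cross_gt0P.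
- by apply/set0Pn; exists r; rewrite !inE eqxx.
- apply: contraTneq (subsetP (pure_sub P) r' r'R) => <-.
  by rewrite in_setU1 in_fiber negb_or nr' r'R.
move=> s [t []]; rewrite in_setU1 => sA; rewrite in_setD in_setU1 negb_or in_fiber.
case/andP=> /andP[ntr ntF] tS st.
have sS : s \in S.
  by move: sA => /orP[/eqP ->//|]; apply: (subsetP (fiber_sub r)).
have rs : rho s = r.
  by move: sA => /orP[/eqP ->|]; [rewrite (pure_fix P) | rewrite in_fiber => /and3P[_ _ /eqP]].
have [E|[sR tR]] := pure_edge P sS tS st.
  case: (boolP (t \in R)) ntF => [tR|_]; last by rewrite tS -E rs eqxx.
  by move: ntr; rewrite -rs E (pure_fix P) ?eqxx.
by exists t; split=> //; rewrite -rs (pure_fix P).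
Qed.

Lemma pure_single r : R = [set r] -> S = r |: fib r.
Proof.
move=> RE; have rR : r \in R by rewrite RE inE.
apply/eqP; rewrite eqEsubset subUset fiber_sub sub1set (subsetP (pure_sub P)) //.
rewrite !andbT; apply/subsetP => s sS; have := pure_rho P sS.
by rewrite in_setU1 in_fiber RE !inE sS => ->; case: eqVneq.
Qed.

Lemma pure_root r : r \in R -> (r \notin fib r) /\ r \in S.
Proof. by move=> rR; rewrite in_fiber rR (subsetP (pure_sub P)). Qed.

Lemma pure_card1 r : R = [set r] -> #|S| = l.+1.
Proof.
move=> RE; have rR : r \in R by rewrite RE inE.
have /and3P[/eqP Fl _ _] := pure_fiber P rR.
by rewrite [in LHS](pure_single RE) cardsU1 (pure_root rR).1 Fl.
Qed.

End PureOn.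

(** * Bounds for the basic graphs and their addition over components *)

Lemma bounded_nbhd1 Z x : ~~ hasF (Z :\: N x) -> bounded Z (k + 2).
Proof. by move=> hZ; rewrite -[k + 2]add0n; apply: (bounded1 (x := x)); apply: bounded0. Qed.

Lemma bounded_Fplus j C : Fplus j C -> bounded C (k + 2).
Proof.
move=> FC; have [u uC uP] := Fplus_center FC; apply: (bounded_nbhd1 (x := u)).
by apply/negP => /hasF_card; have := Fplus_nbhd FC uC; have := order_F_ge3; nat_lia.
Qed.

Lemma bounded_pure C : pure C -> bounded C (m C).+1.
Proof. by case=> R [rho [P RE]]; exists R; [rewrite RE | apply: pure_isolating P]. Qed.

(** The last alternative is [def(S) >= 1]; the first three are the exceptions, of values -1, 0 and
    0. *)
Definition classified S := [\/ Fplus 0 S : Prop, Fplus 1 S : Prop, pure S | bounded S (m S)].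

Lemma component_split C Y : component C Y -> Y = C :|: (Y :\: C).
Proof. by case=> CY _ _ _; rewrite -{1}(setID Y C) (setIidPr CY). Qed.

Lemma component_weight X C Y : component C Y ->
  m Y + cr Y X = (m C + cr C X) + (m (Y :\: C) + cr (Y :\: C) X).
Proof.
move=> cC; have [CY _ _ zC] := cC; rewrite (msizeD e_sym e_irr CY) zC.
have : cr Y X = cr C X + cr (Y :\: C) X.
  by rewrite -crossUl ?disjointD // -component_split.
lia.
Qed.

Lemma component_glue K C Y n n' : component C Y ->
  bounded (C :\: K) n -> bounded ((Y :\: C) :\: K) n' -> bounded (Y :\: K) (n + n').
Proof.
move=> cC bC bY; rewrite {1}(component_split cC) setDUl; apply: boundedU => //.
have [_ _ _ zC] := cC.
by apply: cross0 => x y /setDP[xC _] /setDP[yYC _]; rewrite (cross0_adj zC).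
Qed.

Lemma component_rest C Y : component C Y -> #|Y :\: C| < #|Y|.
Proof.
by case=> CY C0 _ _; move: C0; rewrite -[X in _ < X](cardsID C Y) (setIidPr CY) -card_gt0; lia.
Qed.

(** Components are peeled off one at a time. Bounds and weights both add up, as no edge joins two
    components. *)
Lemma glue X K Y : (forall C, component C Y -> bounded (C :\: K) (m C + cr C X)) ->
  bounded (Y :\: K) (m Y + cr Y X).
Proof.
have [n] := ubnP #|Y|; elim: n Y => // n IH Y Yn H.
case: (eqVneq Y set0) => [->|Y0].
  by apply: bounded_card; rewrite set0D cards0; have := order_F_ge3; nat_lia.
have [C cC] := component_exists Y0; rewrite (component_weight X cC).
apply: (component_glue cC); first exact: H.
by apply: IH => [|C' /(component_trans cC)/H//]; apply: leq_trans (component_rest cC) Yn.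
Qed.

(** * Graphs in which no copy can be cut off by a vertex *)

Section NoDetachable.
Variable S : {set T}.
Hypothesis cS : conn S.
Hypothesis IH : forall C, C \proper S -> conn C -> classified C.
(* [C] would be a component of [S :\ x] if no edge left it, as copies of [F] and [F + e] are
   connected. *)
Hypothesis NP : forall x j C, x \in S -> j <= 1 -> C \subset S :\ x -> Fplus j C ->
  0 < cr C ((S :\ x) :\: C).

Lemma exit_avoiding x j C : x \in S -> x \notin C -> j <= 1 -> C \subset S -> Fplus j C ->
  exists s z, [/\ s \in C, z \in S :\: C, z != x & e s z].
Proof.
move=> xS xC j1 CS FC; have CSx : C \subset S :\ x.
  by apply/subsetP => y yC; rewrite !inE (subsetP CS) // andbT; apply: contraNneq xC => <-.
case/cross_gt0P: (NP xS j1 CSx FC) => s [z [sC]].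
rewrite !inE => /and3P[zC nzx zS] sz; exists s, z; split=> //; by rewrite inE zC.
Qed.

(** Connectedness gives one exit, ending at some [z]; as [C] is not cut off by [z], there is another
    exit that does not end at [z]. *)
Lemma exits_ge2 j C : j <= 1 -> Fplus j C -> C \proper S -> 1 < cr C (S :\: C).
Proof.
move=> j1 FC; rewrite properEneq => /andP[nCS CS].
have C0 : C != set0 by have [u uC _] := Fplus_center FC; apply/set0Pn; exists u.
case/cross_gt0P: (cS CS C0 nCS) => s [z [sC zSC sz]].
have /setDP[zS zC] := zSC.
have [s' [z' [s'C z'SC nz' sz']]] := exit_avoiding zS zC j1 CS FC.
by apply: (cross_gt1 e_sym sC zSC sz s'C z'SC sz'); rewrite xpair_eqE negb_and (eq_sym z) nz' orbT.
Qed.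

Lemma component_cross X C : X \subset S -> component C (S :\: X) -> cr C X = cr C (S :\: C).
Proof.
move=> XS [CX _ _ zC].
have -> : S :\: C = X :|: ((S :\: X) :\: C).
  apply/setP => x; rewrite !inE; have := subsetP XS x; have := subsetP CX x; rewrite !inE.
  by case: (x \in C); case: (x \in X); case: (x \in S) => //= H1 H2;
     do ?[by have := H1 isT | by have := H2 isT].
rewrite crossUr // ?zC ?addn0 // -setI_eq0; apply/eqP/setP => x; rewrite !inE.
by case: (x \in X); rewrite ?andbF.
Qed.

Lemma component_proper X C : X \subset S -> X != set0 -> component C (S :\: X) -> C \proper S.
Proof.
move=> XS /set0Pn[x xX] [CX _ _ _]; rewrite properE (subset_trans CX (subsetDl _ _)).
apply/subsetPn; exists x; first exact: (subsetP XS).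
by apply/negP => /(subsetP CX); rewrite inE xX.
Qed.

Lemma component_cross_gt0 X C : X \subset S -> X != set0 -> component C (S :\: X) -> 0 < cr C X.
Proof.
move=> XS X0 cC; rewrite (component_cross XS cC).
have := component_proper XS X0 cC; rewrite properEneq => /andP[nC CS].
by case: cC => _ C0 _ _; apply: cS.
Qed.

(** A copy of [F] lacks two edges to pay for its centre and has two exits. The other kinds lack at
    most one edge, and one exit is there by connectedness. *)
Lemma component_bounded X C : X \subset S -> X != set0 -> component C (S :\: X) ->
  bounded C (m C + cr C X).
Proof.
move=> XS X0 cC; have c0 := component_cross_gt0 XS X0 cC.
have CS := component_proper XS X0 cC; have [_ _ conC _] := cC.
case: (IH CS conC) => [FC|FC|pC|bC].
- have c2 := exits_ge2 (leq0n 1) FC CS; rewrite -(component_cross XS cC) in c2.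
  apply: bounded_le (bounded_Fplus FC); case/and3P: FC => _ /eqP -> _; nat_lia.
- apply: bounded_le (bounded_Fplus FC); case/and3P: FC => _ /eqP -> _; nat_lia.
- by apply: bounded_le (bounded_pure pC); nat_lia.
- by apply: bounded_le bC; nat_lia.
Qed.

Lemma rest_bounded X : X \subset S -> X != set0 ->
  bounded (S :\: X) (m (S :\: X) + cr (S :\: X) X).
Proof.
move=> XS X0; rewrite -{1}[S :\: X]setD0; apply: glue => C cC.
by rewrite setD0; apply: component_bounded.
Qed.

Lemma bounded_split X y n : X \subset S -> ~~ hasF (X :\: N y) ->
  cr (X :\: N y) (S :\: X) = 0 -> bounded (S :\: X) n -> bounded S (n + (k + 2)).
Proof.
move=> XS hX zX bX; apply: (bounded1 (x := y)).
apply: (boundedS (Z' := (X :\: N y) :|: (S :\: X))).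
  apply/subsetP => z; rewrite in_setU !in_setD => /andP[-> ->].
  by rewrite !andbT orbN.
by rewrite -[n]add0n; apply: boundedU => //; apply: bounded0.
Qed.

(** The edges inside [X] pay for [y], and the edges between [X] and the rest are credited to the
    rest. *)
Lemma bounded_dominated X y : X \subset S -> X != set0 -> ~~ hasF (X :\: N y) ->
  cr (X :\: N y) (S :\: X) = 0 -> k + 2 <= m X -> bounded S (m S).
Proof.
move=> XS X0 hX zX kX; apply: bounded_le (bounded_split XS hX zX (rest_bounded XS X0)).
by rewrite (msizeD e_sym e_irr XS) cross_sym //; nat_lia.
Qed.

(** Two edges with different ends in [B] already exhaust the bound on [cross e B Q]. *)
Lemma two_exits B Q s1 q1 s2 q2 : cr B Q <= 2 -> s1 \in B -> q1 \in Q -> e s1 q1 ->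
  s2 \in B -> q2 \in Q -> e s2 q2 -> s1 != s2 ->
  forall s q, s \in B -> q \in Q -> e s q -> (s = s1 /\ q = q1) \/ (s = s2 /\ q = q2).
Proof.
move=> c2 s1B q1Q sq1 s2B q2Q sq2 n12.
have H s q a b : s \in B -> q \in Q -> e s q -> a \in B -> b \in Q -> e a b -> s != a ->
    forall a' b', a' \in B -> b' \in Q -> e a' b' -> s != a' -> a' = a /\ b' = b.
  move=> sB qQ sq aB bQ ab nsa a' b' a'B b'Q ab' nsa'.
  apply: (cross_le1 e_sym (X := B :\ s) (Y := Q)); rewrite ?inE // 1?eq_sym ?nsa ?nsa' //.
  have := crossUl e Q (disjointD [set s] B); rewrite (setD1K sB).
  have : 0 < cr [set s] Q by apply/cross_gt0P; exists s, q; rewrite inE.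
  nat_lia.
move=> s q sB qQ sq; case: (eqVneq s1 s) => [E|n1]; [left|right].
  by apply: (H _ _ _ _ s2B q2Q sq2 s1B q1Q sq1); rewrite // 1?eq_sym -?E // eq_sym.
exact: (H _ _ _ _ s1B q1Q sq1 s2B q2Q sq2).
Qed.

Lemma matched_unique Y Y' a b :
  (forall s t, s \in Y -> t \in Y' -> e s t -> s = a /\ t = b) -> matched Y Y' /\ matched Y' Y.
Proof.
move=> H; split=> [s sY|t tY]; rewrite cross1.
  apply: leq_trans (_ : #|[set b]| <= 1); last by rewrite cards1.
  apply: subset_leq_card; apply/subsetP => t; rewrite !inE => /andP[tY st].
  by have [_ ->] := H s t sY tY st.
apply: leq_trans (_ : #|[set a]| <= 1); last by rewrite cards1.
apply: subset_leq_card; apply/subsetP => s; rewrite !inE e_sym => /andP[sY st].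
by have [-> _] := H s t sY tY st.
Qed.

Lemma setD_nbhd1 Q x q : x \notin Q -> (forall q', q' \in Q -> e x q' = (q' == q)) ->
  Q :\: N x = Q :\ q.
Proof.
move=> xQ H; apply/setP => y; rewrite !in_setD in_nbhd1 in_set1.
case yQ: (y \in Q); rewrite ?andbF // H // !andbT negb_or.
by case: (eqVneq y x) => // yx; rewrite yx (negbTE xQ) in yQ.
Qed.

(** Deleting [N x] takes at least two vertices from each side and leaves at most one edge across. A
    copy in what remains would need a side with [l - 1] vertices. *)
Lemma two_Fplus_isolated_at i j B Q x : Fplus i B -> Fplus j Q -> [disjoint B & Q] -> cr B Q <= 3 ->
  x \in B -> 1 < cr [set x] Q -> ~~ hasF ((B :|: Q) :\: N x).
Proof.
move=> FB FQ dBQ c3 xB cx; rewrite setDUl; apply/negP.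
have Bl := Fplus_nbhd FB xB.
have Ql : #|Q :\: N x| + 2 <= l.
  case/and3P: FQ => /eqP <- _ _; rewrite -(cardsID (N x) Q) addnC leq_add2r.
  apply: leq_trans cx _; rewrite cross1; apply: subset_leq_card; apply/subsetP => q.
  by rewrite inE in_setI in_nbhd1 => /andP[-> ->]; rewrite orbT.
have c1 : cr (B :\ x) Q <= 1.
  by have := crossUl e Q (disjointD [set x] B); rewrite (setD1K xB); nat_lia.
have BS : B :\: N x \subset B :\ x.
  by apply: setDS; rewrite sub1set in_nbhd1 eqxx.
have d : [disjoint B :\: N x & Q :\: N x].
  apply: disjointWl (subsetDl _ _) _; apply: disjointWr (subsetDl _ _) dBQ.
have m1 : matched (B :\: N x) (Q :\: N x).
  move=> y yB; apply: leq_trans c1; apply: crossS; rewrite // ?subsetDl // sub1set.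
  exact: (subsetP BS).
have m2 : matched (Q :\: N x) (B :\: N x).
  move=> y yQ; rewrite cross_sym //; apply: leq_trans c1; apply: crossS => //.
  by rewrite sub1set; move: yQ; rewrite inE => /andP[].
have [Bl' Ql'] : #|B :\: N x| < l /\ #|Q :\: N x| < l by split; nat_lia.
case/(hasF_across d Bl' Ql' m1 m2)=> y [y' [_ _ _ [[_ Yl _ _]|[_ Yl _ _]]]]; nat_lia.
Qed.

(** If no vertex has two neighbours across, the crossing edges form a matching. Failure of an end
    [x] of a crossing edge [x q] then gives another crossing edge [x' q'] with [full (Q :\ q) q'];
    failure of [x'] as well contradicts [full_full]. *)
Lemma two_Fplus_isolated i B Q : Fplus i B -> Fplus 0 Q -> [disjoint B & Q] -> cr B Q <= 3 ->
  0 < cr B Q -> exists x, ~~ hasF ((B :|: Q) :\: N x).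
Proof.
move=> FB FQ dBQ c3 c0.
case: (boolP [exists x in B, 1 < cr [set x] Q]) => [/exists_inP[x xB cx]|/exists_inPn nB].
  by exists x; apply: (two_Fplus_isolated_at FB FQ dBQ c3 xB cx).
case: (boolP [exists y in Q, 1 < cr [set y] B]) => [/exists_inP[y yQ cy]|/exists_inPn nQ].
  exists y; rewrite setUC; apply: (two_Fplus_isolated_at FQ FB _ _ yQ cy).
    by rewrite disjoint_sym.
  by rewrite cross_sym.
have mB : matched B Q by move=> x /nB; rewrite -leqNgt.
have mQ : matched Q B by move=> x /nQ; rewrite -leqNgt.
have QN x q : x \in B -> q \in Q -> e x q -> Q :\: N x = Q :\ q.
  move=> xB qQ xq; apply: setD_nbhd1; first by rewrite (disjointFr dBQ).
  move=> q' q'Q; apply/idP/eqP => [xq'|->//].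
  have xx : x \in [set x] by rewrite inE.
  by case: (cross_le1 e_sym (mB x xB) xx q'Q xq' xx qQ xq).
have H x q : x \in B -> q \in Q -> e x q -> ~~ hasF ((B :|: Q) :\: N x) \/
    exists x' q', [/\ x' \in B, q' \in Q, e x' q' & full (Q :\ q) q'].
  move=> xB qQ xq; case: (boolP (hasF _)) => h; [right|by left].
  have Bl := Fplus_nbhd FB xB.
  have Ql : #|Q :\: N x| < l.
    by rewrite (QN x q) //; case/and3P: FQ => /eqP <- _ _; rewrite (cardsD1 q Q) qQ.
  rewrite setDUl in h; have d : [disjoint B :\: N x & Q :\: N x].
    by apply: disjointWl (subsetDl _ _) _; apply: disjointWr (subsetDl _ _) dBQ.
  have m1 : matched (B :\: N x) (Q :\: N x).
    by move=> y /setDP[yB _]; apply: leq_trans (mB y yB); apply: crossS; rewrite // subsetDl.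
  have m2 : matched (Q :\: N x) (B :\: N x).
    by move=> y /setDP[yB _]; apply: leq_trans (mQ y yB); apply: crossS; rewrite // subsetDl.
  have Bl' : #|B :\: N x| < l by nat_lia.
  have [x' [q' [x'B q'Q xq' [[_ Yl _ _]|f]]]] := hasF_across d Bl' Ql m1 m2 h; first by nat_lia.
  exists x', q'; rewrite -(QN x q) //; case/setDP: x'B => x'B _.
  by case/setDP: (q'Q) => q'Q' _.
case/cross_gt0P: c0 => x [q [xB qQ xq]].
case: (H x q) => // [h|[x' [q' [x'B q'Q xq' f]]]]; first by exists x.
case: (H x' q') => // [h|[x'' [q'' [_ _ _ f']]]]; first by exists x'.
by case: (full_full FQ q'Q f f').
Qed.

(** A fibre is a copy of [F], so it has an exit that does not end at [r]; inside [C] its edges lead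
    nowhere else, so this exit leaves [C]. *)
Lemma fiber_exit C R rho r : C \proper S -> pure_on C R rho -> r \in R ->
  exists s z, [/\ s \in fiber C R rho r, z \in S :\: C & e s z].
Proof.
move=> /proper_sub CS P rR; have [rF rC] := pure_root P rR.
have FC := fiber_sub C R rho r.
have [s [z [sF /setDP[zS zF] nzr sz]]] :=
  exit_avoiding (subsetP CS r rC) rF (leq0n 1) (subset_trans FC CS) (pure_fiber P rR).
exists s, z; split=> //; rewrite inE zS andbT; apply/negP => zC.
by case: (fiber_edge P sF zC sz) => [zr|]; [rewrite zr eqxx in nzr | apply/negP].
Qed.

(** * A pure special part joined to a copy of [F] by at most two edges *)

Section CrossedFibers.
Variables (B Q : {set T}).
Hypotheses (BS : B \subset S) (QE : Q = S :\: B).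
Hypothesis c2 : cr B Q <= 2.
Variables (R : {set T}) (rho : T -> T).
Hypothesis P : pure_on B R rho.
Local Notation fib := (fiber B R rho).

Let dBQ : [disjoint B & Q].
Proof. by rewrite QE disjointD. Qed.

Let SE : S = B :|: Q.
Proof. by rewrite QE -{1}(setID S B) (setIidPr BS). Qed.

(** Choosing [s1] and [s2] destroys both crossing edges, so [B] and [Q] can be treated separately.
    [Q] has lost [q1] and is too small; what is left of [B] is two small pieces joined at most by
    the edge [r1 r2]. *)
Lemma two_fibers_isolated r1 s1 q1 r2 s2 q2 : Fplus 0 Q -> R = [set r1; r2] -> r1 != r2 ->
  s1 \in fib r1 -> q1 \in Q -> e s1 q1 -> s2 \in fib r2 -> q2 \in Q -> e s2 q2 ->
  ~~ hasF (S :\: closed_nbhd e [set s1; s2]).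
Proof.
move=> FQ RE n12 s1F q1Q sq1 s2F q2Q sq2; set D := [set s1; s2].
have r1R : r1 \in R by rewrite RE !inE eqxx.
have r2R : r2 \in R by rewrite RE !inE eqxx orbT.
have FB r := subsetP (fiber_sub B R rho r).
have n : s1 != s2.
  apply: contraNneq n12 => s12; move: s1F s2F.
  by rewrite !in_fiber s12 => /and3P[_ _ /eqP <-] /and3P[_ _ /eqP <-].
have X := two_exits c2 (FB _ _ s1F) q1Q sq1 (FB _ _ s2F) q2Q sq2 n.
have Din s : s \in D -> s \in closed_nbhd e D.
  by move=> sD; rewrite in_nbhd; apply/exists_inP; exists s; rewrite // eqxx.
apply/negP; rewrite SE setDUl => /hasFU[].
- apply: cross0 => s q /setDP[sB sD] /setDP[qQ _]; apply: contra sD => sq.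
  by apply: Din; case: (X s q sB qQ sq) => -[-> _]; rewrite !inE eqxx ?orbT.
(* A constituent has [l + 1] vertices and loses at least [s] and a neighbour of [s]. *)
- have Y s r : r \in R -> s \in fib r -> s \in D ->
      #|(r |: fib r) :\: closed_nbhd e D| < l.
    move=> rR sF sD; have [t tF st] := Fplus_nbr (pure_fiber P rR) sF.
    have := card_nbhd2 (C := r |: fib r) (setU1r r sF) (setU1r r tF) st.
    have /and3P[/eqP Fl _ _] := pure_fiber P rR.
    rewrite cardsU1 (pure_root P rR).1 Fl.
    have := subset_leq_card (setDS (r |: fib r) (sub_nbhd sD)); nat_lia.
  have BE : B :\: closed_nbhd e D = ((r1 |: fib r1) :\: closed_nbhd e D) :|:
      ((r2 |: fib r2) :\: closed_nbhd e D).
    rewrite -setDUl; congr (_ :\: _); apply/eqP.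
    rewrite eqEsubset !subUset !fiber_sub !sub1set !(subsetP (pure_sub P)) // !andbT.
    apply/subsetP => s sB; have := pure_rho P sB; rewrite in_setU !in_setU1 !in_fiber sB.
    by rewrite RE !inE => /orP[] ->; case: (s == r1); case: (s == r2); rewrite ?orbT.
  have dis : [disjoint (r1 |: fib r1) :\: closed_nbhd e D & (r2 |: fib r2) :\: closed_nbhd e D].
    have dr r : r \in R -> forall s, s \in r |: fib r -> rho s = r.
      move=> rR s; rewrite in_setU1 in_fiber => /orP[/eqP ->|/and3P[_ _ /eqP //]].
      exact: pure_fix P _ rR.
    apply/pred0P => s /=; apply/negP => /andP[/setDP[/(dr _ r1R) E1 _] /setDP[/(dr _ r2R) E2 _]].
    by case/eqP: n12; rewrite -E1.
  have edge s t : s \in (r1 |: fib r1) :\: closed_nbhd e D ->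
      t \in (r2 |: fib r2) :\: closed_nbhd e D -> e s t -> s = r1 /\ t = r2.
    have sub r : r \in R -> forall s, s \in r |: fib r -> s \in B.
      by move=> rR a; rewrite in_setU1 => /orP[/eqP ->|/FB//]; case: (pure_root P rR).
    case/setDP=> s1' _ /setDP[t2 _] st; split.
      case/setU1P: (s1') => // sF; case: (fiber_edge P sF (sub _ r2R t t2) st) => [tr|tF].
        case/setU1P: t2 => [tr2|]; first by case/eqP: n12; rewrite -tr.
        by rewrite in_fiber tr r1R.
      case/setU1P: t2 => [tr2|]; first by move: tF; rewrite in_fiber tr2 r2R.
      move: tF; rewrite !in_fiber => /and3P[_ _ /eqP E1] /and3P[_ _ /eqP E2].
      by case/eqP: n12; rewrite -E1 E2.
    rewrite e_sym in st.
    case/setU1P: (t2) => // tF; case: (fiber_edge P tF (sub _ r1R s s1') st) => [sr|sF].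
      case/setU1P: s1' => [sr1|]; first by case/eqP: n12; rewrite -sr.
      by rewrite in_fiber sr r2R.
    case/setU1P: s1' => [sr1|]; first by move: sF; rewrite in_fiber sr1 r1R.
    move: sF; rewrite !in_fiber => /and3P[_ _ /eqP E1] /and3P[_ _ /eqP E2].
    by case/eqP: n12; rewrite -E1 E2.
  have [m1 m2] := matched_unique edge.
  rewrite BE => /(hasF_across dis (Y _ _ r1R s1F (set21 _ _)) (Y _ _ r2R s2F (set22 _ _)) m1 m2).
  case=> y [y' [yY y'Y yy' f]]; have [yE y'E] := edge _ _ yY y'Y yy'.
  (* A centre [r] would need [l - 2 >= 2] neighbours in its piece, but a connection vertex has only
     one neighbour in its fibre. *)
  have H r Z : r \in R -> Z \subset r |: fib r -> full Z r -> False.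
    move=> rR ZF fZ; have := full_l_ge4 fZ; have := full_deg fZ.
    have : cr [set r] (Z :\ r) <= cr [set r] (fib r).
      by apply: crossS => //; rewrite subDset.
    by rewrite (fiber_cross P rR); nat_lia.
  by case: f; rewrite (yE, y'E); apply: H; rewrite // subsetDl.
- apply/negP; apply/negP => /hasF_card; rewrite leqNgt => /negP; apply.
  case/and3P: FQ => /eqP <- _ _; rewrite -(cardsID (closed_nbhd e D) Q).
  rewrite -[X in X < _]add0n ltn_add2r.
  apply/card_gt0P; exists q1; rewrite inE q1Q in_nbhd; apply/exists_inP; exists s1.
    exact: set21.
  by rewrite sq1 orbT.
Qed.

Variable r : T.
Hypothesis RE : R = [set r].

Let rR : r \in R. Proof. by rewrite RE inE. Qed.
Let BE : B = r |: fib r. Proof. exact: pure_single P _ RE. Qed.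

(** Deleting [N s] leaves [s' q'] as the only possible edge across, with fewer than [l] vertices on
    each side, so [hasF_across] applies. *)
Lemma one_fiber_full s q s' q' : Fplus 0 Q -> m B = k.+1 -> s \in fib r -> q \in Q -> e s q ->
  s' \in B -> q' \in Q -> e s' q' -> s != s' -> hasF (S :\: N s) -> full (Q :\ q) q'.
Proof.
move=> FQ mB sF qQ sq s'B q'Q sq' ns.
have sB : s \in B by apply: (subsetP (fiber_sub B R rho r)).
have X := two_exits c2 sB qQ sq s'B q'Q sq' ns.
have FF := pure_fiber P rR; have [t tF st] := Fplus_nbr FF sF.
have tB : t \in B by apply: (subsetP (fiber_sub B R rho r)).
have Bl : #|B :\: N s| < l by have := card_nbhd2 sB tB st; rewrite (pure_card1 P RE); nat_lia.
have QN : Q :\: N s = Q :\ q.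
  apply: setD_nbhd1; first by rewrite (disjointFr dBQ).
  move=> q0 q0Q; apply/idP/eqP => [sq0|->//].
  by case: (X s q0 sB q0Q sq0) => -[// E]; rewrite E eqxx in ns.
have Ql : #|Q :\: N s| < l.
  by rewrite QN; case/and3P: FQ => /eqP <- _ _; rewrite (cardsD1 q Q) qQ.
have edge a b : a \in B :\: N s -> b \in Q :\: N s -> e a b -> a = s' /\ b = q'.
  case/setDP=> aB aN /setDP[bQ _] ab; case: (X a b aB bQ ab) => // -[E _].
  by rewrite E in_nbhd1 eqxx in aN.
have [m1 m2] := matched_unique edge.
have dis : [disjoint B :\: N s & Q :\: N s].
  by apply: disjointWl (subsetDl _ _) _; apply: disjointWr (subsetDl _ _) dBQ.
rewrite SE setDUl => /(hasF_across dis Bl Ql m1 m2)[y [y' [yB y'Q yy']]].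
have [-> ->] := edge _ _ yB y'Q yy'; rewrite QN; case=> // f; exfalso.
(* The alternative [full (B :\: N s) s'] fails by counting edges: [N s] contains the centre [u] of
   the fibre, and deleting [u] costs at least [l - 1 >= 3] of the [k + 1] edges of [B]. *)
have [u uF uP] := Fplus_center FF.
have uB : u \in B by apply: (subsetP (fiber_sub B R rho r)).
have YB : B :\: N s \subset B :\ u.
  apply: setDS; rewrite sub1set; have := subsetP uP s sF; rewrite !in_nbhd1 e_sym.
  by rewrite eq_sym.
have du : l <= (cr [set u] (B :\ u)).+1.
  case/and3P: FF => /eqP <- _ _; rewrite (cardsD1 u) uF cross1 ltnS.
  apply: subset_leq_card; apply/subsetP => z /setD1P[nzu zF]; rewrite !inE nzu.
  rewrite (subsetP (fiber_sub B R rho r)) //=.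
  by have := subsetP uP z zF; rewrite in_nbhd1 (negbTE nzu).
have := full_l_ge4 f; case: f => _ _ kY _; have := msizeS e YB.
have := msizeD1 e_sym e_irr uB; nat_lia.
Qed.

(** One of [s1], [s2] and [q1] works. If [s1] and [s2] both fail and [s2] lies in the fibre,
    [full_full] is contradicted in [Q]. So [s2] is [r], and its failure constrains the fibre;
    failure of [q1] then gives a contradiction in the fibre or at [r]. *)
Lemma one_fiber_isolated s1 q1 s2 q2 : Fplus 0 Q -> m B = k.+1 ->
  s1 \in fib r -> q1 \in Q -> e s1 q1 ->
  s2 \in B -> q2 \in Q -> e s2 q2 -> s1 != s2 -> exists x, ~~ hasF (S :\: N x).
Proof.
move=> FQ mB s1F q1Q sq1 s2B q2Q sq2 n12.
case: (boolP (hasF (S :\: N s1))) => [h1|]; last by exists s1.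
have f1 := one_fiber_full FQ mB s1F q1Q sq1 s2B q2Q sq2 n12 h1.
have FB := subsetP (fiber_sub B R rho r); have s1B := FB s1 s1F.
case: (boolP (hasF (S :\: N s2))) => [h2|]; last by exists s2.
case/setU1P: (eq_rect B (fun Z : {set T} => s2 \in Z) s2B _ BE) => [s2r|s2F]; last first.
  have f2 := one_fiber_full FQ mB s2F q2Q sq2 s1B q1Q sq1 _ h2.
  by case: (full_full FQ q2Q f1 (f2 _)); rewrite eq_sym.
case: (boolP (hasF (S :\: N q1))) => [h3|]; last by exists q1.
have X := two_exits c2 s1B q1Q sq1 s2B q2Q sq2 n12; rewrite s2r in X h2 sq2 n12 s2B.
have FF := pure_fiber P rR; have [/eqP Fl _ _] := and3P FF; have [/eqP Ql _ _] := and3P FQ.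
have [w wF wP] := pure_attach P rR; have [rF _] := pure_root P rR.
have [q2q1 _ _ _] := f1; have n21 : q2 != q1 by case/setD1P: q2q1.
have inB z : z \in B -> z = r \/ z \in fib r by rewrite {1}BE => /setU1P.
have rN : B :\: N r = fib r :\ w.
  rewrite {1}BE setDUl (_ : [set r] :\: N r = set0) ?set0U; last first.
    by apply/eqP; rewrite setD_eq0 sub1set in_nbhd1 eqxx.
  by apply: setD_nbhd1.
have rQ : Q :\: N r = Q :\ q2.
  apply: setD_nbhd1; first by rewrite (disjointFr dBQ).
  move=> q qQ; apply/idP/eqP => [rq|->//].
  by case: (X r q s2B qQ rq) => -[// E]; rewrite -E eqxx in n12.
(* After deletion of [N r] only [s1 q1] crosses. The [Q] side cannot be full, by [full_full], so the
   fibre side is. *)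
have fw : full (fib r :\ w) s1.
  have edge a b : a \in fib r :\ w -> b \in Q :\ q2 -> e a b -> a = s1 /\ b = q1.
    case/setD1P=> _ aF /setD1P[nb bQ] ab.
    by case: (X a b (FB _ aF) bQ ab) => -[// _ E]; rewrite E eqxx in nb.
  have [m1 m2] := matched_unique edge.
  move: h2; rewrite SE setDUl rN rQ => /(hasF_across _ _ _ m1 m2)[].
  - apply: disjointWl (subsetDl _ _) _; apply: disjointWr (subsetDl _ _) _.
    exact: disjointWl (fiber_sub _ _ _ _) dBQ.
  - by rewrite -Fl (cardsD1 w (fib r)) wF.
  - by rewrite -Ql (cardsD1 q2 Q) q2Q.
  move=> y [y' [yF y'Q yy']]; have [-> ->] := edge _ _ yF y'Q yy'; case=> // f2.
  by case: (full_full FQ q2Q f1 f2).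
have rq1 : r \notin N q1.
  rewrite in_nbhd1 e_sym negb_or; apply/andP; split.
    by apply: contraTneq q1Q => <-; rewrite (disjointFr dBQ).
  apply/negP => /(X r q1 s2B q1Q)[] [E1 E2]; first by rewrite -E1 eqxx in n12.
  by rewrite E2 eqxx in n21.
have q1F : fib r :\: N q1 = fib r :\ s1.
  apply: setD_nbhd1; first by apply: contraTN q1Q => /FB q1B; rewrite (disjointFr dBQ).
  move=> a aF; rewrite e_sym; apply/idP/eqP => [/(X a q1 (FB _ aF) q1Q)[] [-> //]|->//].
  by move=> E; rewrite E eqxx in n21.
(* The vertex [r] is moved to the side of [Q]. The edge [r q2] no longer crosses, and the attaching
   edge [w r] is the only one that does. *)
have edge a b : a \in fib r :\ s1 -> b \in r |: Q :\: N q1 -> e a b -> a = w /\ b = r.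
  case/setD1P=> na aF /setU1P[->|/setDP[bQ bN]] ab.
    by split=> //; apply/eqP; rewrite -wP // e_sym.
  case: (X a b (FB _ aF) bQ ab) => -[E _]; first by rewrite E eqxx in na.
  by move: aF; rewrite E (negbTE rF).
have [m1 m2] := matched_unique edge.
have SN : S :\: N q1 = (fib r :\ s1) :|: (r |: (Q :\: N q1)).
  rewrite {1}SE {1}BE !setDUl q1F (_ : [set r] :\: N q1 = [set r]).
    by rewrite (setUC [set r]) -setUA.
  by apply/setDidPl; rewrite disjoints1.
move: h3; rewrite SN => /(hasF_across _ _ _ m1 m2)[].
- apply/pred0P => z /=; apply/negP => /andP[/setD1P[_ zF] /setU1P[zr|/setDP[zQ _]]].
    by move: zF; rewrite zr (negbTE rF).
  by rewrite (disjointFr dBQ (FB _ zF)) in zQ.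
- by rewrite -Fl (cardsD1 s1 (fib r)) s1F.
- by have := Fplus_nbhd FQ q1Q; rewrite cardsU1; nat_lia.
move=> y [y' [yF y'Q yy']]; have [-> ->] := edge _ _ yF y'Q yy'; case=> [f|f]; exfalso.
  exact: (full_full FF s1F fw f).
(* On this side [r] has no neighbour other than [q2], while a full centre needs at least two. *)
have := full_l_ge4 f; have := full_deg f; rewrite setU1K; last first.
  by rewrite inE negb_and (disjointFr dBQ) // orbT.
suff : cr [set r] (Q :\: N q1) <= 1 by nat_lia.
apply: leq_trans (_ : #|[set q2]| <= 1); last by rewrite cards1.
rewrite cross1; apply: subset_leq_card; apply/subsetP => q.
rewrite in_set in_set1 => /andP[/setDP[qQ _] /(X r q s2B qQ)[] [E1 ->]] //.
by rewrite -E1 eqxx in n12.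
Qed.

End CrossedFibers.

(** At least two edges join [Q] to its complement [B]. The centre of [Q] together with an optimal
    set for [B] suffices unless [B] is a copy of [F] or [F + e] with at most three edges across, or
    [B] is pure with exactly two. In the pure case every fibre has its own exit, so there are at
    most two fibres. *)
Lemma attached_copy Q : Fplus 0 Q -> Q \proper S -> conn (S :\: Q) -> bounded S (m S).
Proof.
move=> FQ QpS cB; have /properP[QS [z zS zQ]] := QpS; set B := S :\: Q in cB.
have BS : B \subset S by apply: subsetDl.
have [q0 q0Q q0P] := Fplus_center FQ.
have BpS : B \proper S.
  by rewrite properE BS; apply/subsetPn; exists q0; rewrite ?(subsetP QS) // inE q0Q.
have QE : Q = S :\: B by rewrite setDDr setDv set0U (setIidPr QS).
have dBQ : [disjoint B & Q] by rewrite disjoint_sym disjointD.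
have SE : S = B :|: Q by rewrite setUC -{1}(setID S Q) (setIidPr QS).
have mS : m S = m B + k + cr B Q.
  by rewrite SE msizeU //; case/and3P: FQ => _ /eqP -> _; rewrite addn0.
have c2 : 1 < cr B Q by rewrite cross_sym //; apply: exits_ge2 FQ QpS.
have ext n : bounded B n -> bounded S (n + (k + 2)).
  move=> bB; apply: (bounded1 (x := q0)); apply: boundedS bB.
  by rewrite /B setDS.
have small i : Fplus i B -> bounded S (m S).
  move=> FB; case: (leqP (cr B Q) 3) => [c3|c4].
    have [x] := two_Fplus_isolated FB FQ dBQ c3 (ltnW c2); rewrite -SE => /bounded_nbhd1.
    apply: bounded_le; case/and3P: FB => _ /eqP mB _; nat_lia.
  by apply: bounded_le (ext _ (bounded_Fplus FB)); case/and3P: FB => _ /eqP mB _; nat_lia.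
case: (IH BpS cB) => [|||bB]; [exact: small|exact: small| |]; last first.
  by apply: bounded_le (ext _ bB); nat_lia.
case=> R [rho [P RE]]; case: (leqP (cr B Q) 2) => [c2'|c3]; last first.
  have pB : pure B by exists R, rho.
  by apply: bounded_le (ext _ (bounded_pure pB)); nat_lia.
have exit r : r \in R -> exists s q, [/\ s \in fiber B R rho r, q \in Q & e s q].
  by move=> rR; have := fiber_exit BpS P rR; rewrite -QE.
have FB r := subsetP (fiber_sub B R rho r).
have /set0Pn[r1 r1R] : R != set0 by apply/negP => /eqP R0; rewrite R0 cards0 in RE.
have [s1 [q1 [s1F q1Q sq1]]] := exit r1 r1R.
case: (eqVneq (R :\ r1) set0) => [R1|/set0Pn[r2]].
  have R1E : R = [set r1] by rewrite -(setD1K r1R) R1 setU0.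
  have mB : m B = k.+1 by move: RE; rewrite R1E cards1; nat_lia.
  have s1S : s1 \in S by apply: (subsetP BS); apply: FB s1F.
  have s1Q : s1 \notin Q by rewrite (disjointFr dBQ) // (FB _ _ s1F).
  (* The exit of [Q] is chosen to avoid [s1], so the two crossing edges have distinct ends in
     [B]. *)
  have [q2 [s2 [q2Q s2B n21 qs2]]] := exit_avoiding s1S s1Q (leq0n 1) QS FQ.
  rewrite e_sym in qs2; rewrite eq_sym in n21.
  have [x hx] := one_fiber_isolated BS QE c2' P R1E FQ mB s1F q1Q sq1 s2B q2Q qs2 n21.
  by apply: bounded_le (bounded_nbhd1 hx); nat_lia.
case/setD1P=> n21 r2R; have [s2 [q2 [s2F q2Q sq2]]] := exit r2 r2R.
have nfib r r' s : s \in fiber B R rho r -> s \in fiber B R rho r' -> r = r'.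
  by rewrite !in_fiber => /and3P[_ _ /eqP <-] /and3P[_ _ /eqP <-].
have n12 : s1 != s2.
  by apply: contraNneq n21 => s12; rewrite (nfib r2 r1 s1) // s12.
have X := two_exits c2' (FB _ _ s1F) q1Q sq1 (FB _ _ s2F) q2Q sq2 n12.
have R12 : R = [set r1; r2].
  apply/eqP; rewrite eqEsubset subUset !sub1set r1R r2R /= andbT; apply/subsetP => r rR.
  have [s [q [sF qQ sq]]] := exit r rR.
  case: (X s q (FB _ _ sF) qQ sq) => -[E _]; rewrite E in sF.
    by rewrite (nfib r r1 s1) // !inE eqxx.
  by rewrite (nfib r r2 s2) // !inE eqxx orbT.
exists [set s1; s2].
  by move: RE; rewrite R12 !cards2 n12 eq_sym n21; nat_lia.
by apply: (two_fibers_isolated BS QE c2' P FQ R12 _ s1F q1Q sq1 s2F q2Q sq2); rewrite eq_sym.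
Qed.

(** Every fibre has an exit and there is only one edge out, so [C] is a single constituent and its
    exit [y x] starts in the fibre. The vertex [y] deals with [x |: C], which has at least [k + 2]
    edges; after deletion of [N y] nothing in it is joined to the rest. *)
Lemma bridged_pure X C : X \subset S -> X != set0 -> component C (S :\: X) -> pure C ->
  cr C X = 1 -> bounded S (m S).
Proof.
move=> XS X0 cC [R [rho [P RE]]] c1; rewrite (component_cross XS cC) in c1.
have CpS := component_proper XS X0 cC; have CS := proper_sub CpS.
have /set0Pn[r rR] : R != set0 by apply/negP => /eqP R0; rewrite R0 cards0 in RE.
have [y [x [yF xC yx]]] := fiber_exit CpS P rR.
have FC r' := subsetP (fiber_sub C R rho r'); have yC := FC _ _ yF.
have c1' : cr C (S :\: C) <= 1 by rewrite c1.
have R1 : R = [set r].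
  apply/eqP; rewrite eqEsubset sub1set rR andbT; apply/subsetP => r' r'R.
  have [y' [x' [y'F x'C yx']]] := fiber_exit CpS P r'R.
  have [E _] := cross_le1 e_sym c1' yC xC yx (FC _ _ y'F) x'C yx'.
  move: yF y'F; rewrite -E !in_fiber inE => /and3P[_ _ /eqP <-] /and3P[_ _ /eqP <-].
  by [].
have /setDP[xS nxC] := xC.
apply: (bounded_dominated (X := x |: C) (y := y)).
- by rewrite subUset sub1set xS CS.
- by apply/set0Pn; exists x; rewrite setU11.
- apply/negP => /hasF_card; have [t tF yt] := Fplus_nbr (pure_fiber P rR) yF.
  have := card_nbhd2 yC (FC _ _ tF) yt; rewrite (pure_card1 P R1).
  suff /subset_leq_card : (x |: C) :\: N y \subset C :\: N y by nat_lia.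
  apply/subsetP => z; rewrite !in_setD in_setU1 => /andP[zN /orP[/eqP zx|->]]; last by rewrite zN.
  by rewrite zx in_nbhd1 yx orbT in zN.
- apply: cross0 => a b /setDP[aX aN] /setDP[bS]; rewrite in_setU1 negb_or => /andP[nbx bC].
  case/setU1P: aX => [ax|aC]; first by rewrite ax in_nbhd1 yx orbT in aN.
  apply/negP => ab; have bSC : b \in S :\: C by rewrite inE bC.
  have [_ E] := cross_le1 e_sym c1' yC xC yx aC bSC ab.
  by rewrite E eqxx in nbx.
- rewrite msizeU ?disjoints1 // msize1 //.
  have : 0 < cr [set x] C by apply/cross_gt0P; exists x, y; rewrite set11 yC e_sym.
  by move: RE; rewrite R1 cards1; nat_lia.
Qed.

Lemma no_detachable_classified : hasF S -> classified S.
Proof.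
case/hasF_star=> W [v [WS vW Wl hW vP]]; have kW := hasF_msize hW.
have vS := subsetP WS v vW; pose X := S :&: N v.
have XS : X \subset S by apply: subsetIl.
have vX : v \in X by rewrite inE vS in_nbhd1 eqxx.
have X0 : X != set0 by apply/set0Pn; exists v.
have WX : W \subset X.
  apply/subsetP => y yW; rewrite inE (subsetP WS) // in_nbhd1.
  by case: eqVneq => //= ny; apply: vP.
have XN : X \subset N v by apply: subsetIr.
have cX : conn X := conn_star XN vX.
(* Each vertex of [X] outside the copy brings an edge of its own, the one to [v]. So [m X] controls
   the size of [X]. *)
have dX : #|X :\: W| <= cr W (X :\: W).
  apply: (@leq_trans (cr [set v] (X :\: W))); last by rewrite crossS // sub1set.
  rewrite cross1; apply: subset_leq_card; apply/subsetP => y yXW; rewrite inE yXW /=.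
  case/setDP: yXW => yX yW; have := subsetP XN y yX; rewrite in_nbhd1.
  by case/orP=> // /eqP yv; rewrite yv vW in yW.
have mX := msizeD e_sym e_irr WX.
have XW : #|X| = l + #|X :\: W| by rewrite -Wl -(cardsID W X) (setIidPr WX).
have hX : hasF X := hasFS WX hW.
have hXN : ~~ hasF (X :\: N v).
  apply/negP => /hasF_card; have -> : X :\: N v = set0 by apply/eqP; rewrite setD_eq0.
  by rewrite cards0; have := order_F_ge3; nat_lia.
have zXN : cr (X :\: N v) (S :\: X) = 0.
  by apply: cross0 => a b /setDP[/setIP[_ ->]].
have FX : m X = k -> Fplus 0 X.
  by move=> mXk; rewrite /Fplus hX XW; apply/and3P; split=> //; apply/eqP; nat_lia.
case: (leqP (k + 2) (m X)) => mX2.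
  by apply: Or44; apply: bounded_dominated hXN zXN mX2.
case: (eqVneq (S :\: X) set0) => [SX|SX].
  have SE : S = X by apply/eqP; rewrite eqEsubset XS -setD_eq0 SX eqxx.
  case: (m X =P k) => [mXk|mXk]; first by apply: Or41; rewrite SE FX.
  case: (posnP #|X :\: W|) => W0.
    by apply: Or42; rewrite SE /Fplus hX XW; apply/and3P; split=> //; apply/eqP; nat_lia.
  (* Here [S] is [W] plus a pendant vertex attached to [v], and [W] is detachable. *)
  case/card_gt0P: (W0) => z /setDP[zX zW].
  have FW : Fplus 0 W.
    by rewrite /Fplus Wl eqxx hW andbT /=; apply/eqP; nat_lia.
  have WSz : W \subset S :\ z.
    by apply/subsetP => y yW; rewrite !inE (subsetP WS) // andbT; apply: contraNneq zW => <-.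
  have := NP (subsetP XS z zX) (leq0n 1) WSz FW; rewrite SE (_ : X :\ z :\: W = set0).
    by rewrite /cross; under eq_bigr do rewrite big_set0; rewrite big1.
  apply/eqP; rewrite -cards_eq0 setDDl setUC -setDDl; have := cardsD1 z (X :\: W).
  by rewrite inE zW zX /=; nat_lia.
have Or n : n <= m S -> bounded S n -> classified S by move=> nS /(bounded_le nS); apply: Or44.
(* Either [S] is settled at once or [C] has a surplus of at least one. *)
have strict C : component C (S :\: X) ->
    bounded S (m S) \/ exists2 n, n < m C + cr C X & bounded C n.
  move=> cC; have CpS := component_proper XS X0 cC; have [_ _ conC _] := cC.
  have c0 := component_cross_gt0 XS X0 cC.
  case: (IH CpS conC) => [FC|FC|pC|bC].
  (* The complement of [C] is connected because [X] is. *)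
  - by left; apply: attached_copy FC CpS (conn_setD cS XS X0 cX cC).
  - right; exists (k + 2); last exact: bounded_Fplus FC.
    have := exits_ge2 (leqnn 1) FC CpS; rewrite -(component_cross XS cC).
    by case/and3P: FC => _ /eqP -> _; nat_lia.
  - case: (leqP (cr C X) 1) => c1.
      by left; apply: bridged_pure XS X0 cC pC _; nat_lia.
    by right; exists (m C).+1; [nat_lia | apply: bounded_pure].
  - by right; exists (m C); [nat_lia | ].
have rest Y : (forall C, component C Y -> component C (S :\: X)) -> bounded Y (m Y + cr Y X).
  move=> YS; rewrite -[Y in bounded Y _]setD0; apply: glue => C /YS cC.
  by rewrite setD0; apply: component_bounded.
have step C Y n n' : component C Y -> bounded C n -> bounded (Y :\: C) n' -> bounded Y (n + n').
  move=> cC bC bY; rewrite -[Y]setD0; apply: component_glue (cC) _ _; by rewrite setD0.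
have mS : m S = m X + (m (S :\: X) + cr (S :\: X) X).
  by rewrite (msizeD e_sym e_irr XS) cross_sym //; nat_lia.
have [C cC] := component_exists SX; rewrite (component_weight X cC) in mS.
have [|[n nC bC]] := strict C cC; first exact: Or.
have cCt C' := @component_trans (S :\: X) C C' cC.
(* With [m X = k + 1], the surplus of one component completes the price [k + 2] of [v]. *)
case: (m X =P k) => [mXk|mXk]; last first.
  by apply: Or (bounded_split XS hXN zXN (step _ _ _ _ cC bC (rest _ cCt))); nat_lia.
(* Now [X] is itself a copy of [F], one edge further short. If [C] is the only component, the
   complement of [X] is connected; otherwise two components give the surplus of two. *)
case: (eqVneq ((S :\: X) :\: C) set0) => [SXC|SXC].
  apply: Or (attached_copy (FX mXk) _ _) => //.
    by rewrite properEneq XS andbT; apply: contraNneq SX => ->; rewrite setDv.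
  by rewrite (component_split cC) SXC setU0; case: cC.
have [C' cC'] := component_exists SXC; rewrite (component_weight X cC') in mS.
have [|[n' nC' bC']] := strict C' (cCt _ cC'); first exact: Or.
have bR := rest _ (fun C'' c => cCt _ (component_trans cC' c)).
by apply: Or (bounded_split XS hXN zXN (step _ _ _ _ cC bC (step _ _ _ _ cC' bC' bR))); nat_lia.
Qed.
End NoDetachable.

(** * Graphs with a copy cut off by a vertex *)

Lemma pure_on1 C y : y \in C -> Fplus 0 (C :\ y) -> cr [set y] (C :\ y) = 1 ->
  pure_on C [set y] (fun=> y).
Proof.
move=> yC FC c1; have FE r : r \in [set y] -> fiber C [set y] (fun=> y) r = C :\ y.
  by move=> /set1P ->; apply/setP => s; rewrite !inE eqxx andbT.
split=> [|s _|r /set1P ->|||] //; rewrite ?sub1set ?set11 //; first by left.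
  by move=> r rR; rewrite FE.
move=> r rR; rewrite FE //; move/set1P: rR => ->; move/eqP: c1; rewrite cross1 => /cards1P[w wE].
have inw s : (s \in C :\ y) && e y s = (s == w) by rewrite -in_set1 -wE inE.
exists w => [|s sC]; first by have /andP[] : (w \in C :\ y) && e y w by rewrite inw.
by rewrite -inw sC.
Qed.

(** Edges across join connection vertices only, so the fibres of both parts survive unchanged. *)
Lemma pure_onU A A' R R' rho rho' : [disjoint A & A'] ->
  pure_on A R rho -> pure_on A' R' rho' ->
  (forall a a', a \in A -> a' \in A' -> e a a' -> a \in R /\ a' \in R') ->
  pure_on (A :|: A') (R :|: R') (fun s => if s \in A then rho s else rho' s).
Proof.
move=> dA P P' H; set rho2 := fun s => _.
have dA' s : s \in A' -> s \in A = false by move=> sA'; rewrite (disjointFl dA).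
have RA r : r \in R -> r \in A by apply: (subsetP (pure_sub P)).
have RA' r : r \in R' -> r \in A' by apply: (subsetP (pure_sub P')).
have rho2A s : s \in A -> rho2 s = rho s by rewrite /rho2 => ->.
have rho2A' s : s \in A' -> rho2 s = rho' s by rewrite /rho2 => /dA' ->.
have F r : r \in R -> fiber (A :|: A') (R :|: R') rho2 r = fiber A R rho r.
  move=> rR; apply/setP => s; rewrite !in_fiber !in_setU negb_or.
  case sA: (s \in A).
    rewrite rho2A //= (_ : s \in R' = false) ?andbT //.
    by apply/negP => /RA'/dA'; rewrite sA.
  rewrite andbF /=; case sA': (s \in A'); rewrite ?andbF //= rho2A' //.
  apply/negP => /andP[_ /eqP E]; have := dA' _ (RA' _ (pure_rho P' sA')).
  by rewrite E RA.
have F' r : r \in R' -> fiber (A :|: A') (R :|: R') rho2 r = fiber A' R' rho' r.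
  move=> rR'; apply/setP => s; rewrite !in_fiber !in_setU negb_or.
  case sA': (s \in A').
    rewrite rho2A' // orbT /= (_ : s \in R = false) //.
    by apply/negP => /RA; rewrite dA'.
  rewrite orbF andbF /=; case sA: (s \in A); rewrite ?andbF //= rho2A //.
  apply/negP => /andP[_ /eqP E]; have := dA' _ (RA' _ rR').
  by rewrite -E RA // (pure_rho P).
split.
- by rewrite setUSS ?(pure_sub P) ?(pure_sub P').
- move=> s /setUP[sA|sA']; rewrite in_setU.
    by rewrite rho2A // (pure_rho P).
  by rewrite rho2A' // (pure_rho P') // orbT.
- by move=> r /setUP[rR|rR']; [rewrite rho2A ?RA // (pure_fix P)|
     rewrite rho2A' ?RA' // (pure_fix P')].
- move=> s t /setUP[sA|sA'] /setUP[tA|tA'] st; rewrite !in_setU.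
  + by rewrite !rho2A //; case: (pure_edge P sA tA st) => [->|[-> ->]]; [left|right].
  + by right; have [-> ->] := H s t sA tA' st; rewrite orbT.
  + by right; rewrite e_sym in st; have [-> ->] := H t s tA sA' st; rewrite orbT.
  + by rewrite !rho2A' //; case: (pure_edge P' sA' tA' st) => [->|[-> ->]];
      [left|right; rewrite !orbT].
- by move=> r /setUP[rR|rR']; [rewrite F // (pure_fiber P) | rewrite F' // (pure_fiber P')].
- by move=> r /setUP[rR|rR']; [rewrite F //; apply: (pure_attach P)|
     rewrite F' //; apply: (pure_attach P')].
Qed.

(* [Y] decomposes into constituents, and [x] may be joined to it as a further connection vertex. *)
Definition pure_at x Y := exists R rho, [/\ pure_on Y R rho,
  #|R| * (k + 2) = m Y + cr Y [set x] & forall y, y \in Y -> e x y -> y \in R].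

(** Once [x] has been chosen, [Y] with its edges to [x] has a surplus of at least one. *)
Definition strict_at x Y := exists2 n, n < m Y + cr Y [set x] & bounded (Y :\: N x) n.

(** Since [x] dominates a vertex of [C], a copy of [F] or [F + e] costs nothing more. A bounded [C]
    gains from an edge to [x], a pure one from a second edge. What remains is a pure [C] with a
    single edge [x y], where [y] may lie inside a fibre. *)
Lemma component_strict_or_pure S x C : conn S -> x \in S -> component C (S :\ x) ->
  classified C -> strict_at x C \/ pure_at x C.
Proof.
move=> cS xS cC; have xS' : [set x] \subset S by rewrite sub1set.
have x0 : [set x] != set0 by apply/set0Pn; exists x; rewrite set11.
have c0 := component_cross_gt0 cS xS' x0 cC; have [CS _ conC _] := cC.
have xC : x \notin C by apply/negP => /(subsetP CS); rewrite !inE eqxx.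
have small n : bounded C n -> n < m C + cr C [set x] -> strict_at x C.
  by move=> bC nC; exists n => //; apply: boundedS bC; apply: subsetDl.
have /cross_gt0P[y [x' [yC /set1P -> yx]]] := c0.
have yN : y \in N x by rewrite in_nbhd1 e_sym yx orbT.
have CN : #|C :\: N x| < #|C|.
  rewrite -[X in _ < X](cardsID (N x) C) -[X in X < _]add0n ltn_add2r; apply/card_gt0P.
  by exists y; rewrite inE yC.
have tight j : Fplus j C -> strict_at x C.
  move=> FC; exists 0; first by nat_lia.
  by apply: bounded_card; case/and3P: FC => /eqP <-.
case=> [/tight|/tight||bC]; [by left|by left| |by left; apply: small bC _; nat_lia].
move=> pC; case: (leqP (cr C [set x]) 1) => [c1|c2]; last first.
  by left; apply: small (bounded_pure pC) _; nat_lia.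
have ux y' : y' \in C -> e x y' -> y' = y.
  move=> y'C xy'; rewrite e_sym in xy'.
  by have [] := cross_le1 e_sym c1 y'C (set11 x) xy' yC (set11 x) yx.
case: pC => R [rho [P RE]]; case: (boolP (y \in R)) => yR.
  right; exists R, rho; split=> //; first by nat_lia.
  by move=> y' y'C /(ux _ y'C) ->.
pose r := rho y; have rR : r \in R := pure_rho P yC.
have yF : y \in fiber C R rho r by rewrite in_fiber yR yC eqxx.
case: (eqVneq R [set r]) => R1; last first.
  (* [x] dominates [y] and another connection vertex dominates [r], so [r] is superfluous. *)
  left; exists (m C); first by nat_lia.
  exists (R :\ r).
    by move: RE; rewrite (cardsD1 r R) rR; nat_lia.
  have [r' [r'R nr' rr']] := pure_link P conC rR R1.
  have inD z t : z \in R -> z != r -> (t == z) || e z t -> t \in closed_nbhd e (R :\ r).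
    move=> zR nz zt; rewrite in_nbhd; apply/exists_inP; exists z; first by rewrite !inE nz.
    by rewrite eq_sym.
  apply/negP => /(hasF_fiber P)[].
  - by apply: subset_trans (subsetDl _ _) (subsetDl _ _).
  - apply/pred0P => z /=; apply/negP => /andP[/setDP[_ /negP zN] zR]; apply: zN.
    case: (eqVneq z r) => [->|nz]; last by apply: inD zR nz _; rewrite eqxx.
    by apply: inD r'R nr' _; rewrite e_sym rr' orbT.
  move=> z zR /subsetP zF; case: (eqVneq z r) => [zr|nz].
    by have := zF y; rewrite zr yF => /(_ isT); rewrite !in_setD yN andbF.
  have [w wF wP] := pure_attach P zR; have /setDP[_ /negP wN] := zF w wF.
  by apply: wN; apply: inD zR nz _; rewrite wP // eqxx orbT.
case: (boolP (hasF (C :\: N x))) => hC; last first.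
  by left; exists 0; [nat_lia | apply: bounded0].
(* [y] is a leaf of its copy of [F]; it takes over the role of [r]. *)
have CNy : C :\: N x = C :\ y.
  by apply: setD_nbhd1 => // y' y'C; apply/idP/eqP => [/(ux _ y'C)//|->]; rewrite e_sym.
rewrite CNy in hC; have mC := msizeD1 e_sym e_irr yC.
have C1 := pure_card1 P R1; have Cy : #|C :\ y| = l by move: C1; rewrite (cardsD1 y) yC => -[].
have c0y : 0 < cr [set y] (C :\ y).
  apply: conC; rewrite ?sub1set //; first by apply/set0Pn; exists y; rewrite set11.
  by apply/eqP => E; move: C1; rewrite -E cards1; have := order_F_ge3; nat_lia.
have := hasF_msize hC; have RE1 := RE; rewrite R1 cards1 in RE1 => kC.
right; exists [set y], (fun=> y); split; first last.
- by move=> y' y'C /(ux _ y'C) ->; rewrite set11.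
- by rewrite cards1; nat_lia.
apply: pure_on1 => //; last by nat_lia.
by rewrite /Fplus Cy hC eqxx andbT; apply/eqP; nat_lia.
Qed.

Lemma bounded_pure_at x Y : pure_at x Y -> bounded (Y :\: N x) (m Y + cr Y [set x]).
Proof.
case=> R [rho [P RE _]]; apply: (boundedS (subsetDl _ _)).
by exists R; [rewrite RE | apply: pure_isolating P].
Qed.

(** One strict component makes the whole strict, since the pure ones break even; if all are pure,
    their structures unite. *)
Lemma strict_or_pure x Y :
  (forall C, component C Y -> strict_at x C \/ pure_at x C) -> strict_at x Y \/ pure_at x Y.
Proof.
have [n] := ubnP #|Y|; elim: n Y => // n IH Y Yn H.
case: (eqVneq Y set0) => [->|Y0].
  right; exists set0, id; split=> [||y]; last by rewrite inE.
    by split=> [|s|r|s t|r|r]; rewrite ?sub0set // in_set0.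
  have := msize_le e_sym e_irr set0; rewrite /cross big_set0 cards0; nat_lia.
have [C cC] := component_exists Y0; have W := component_weight [set x] cC.
have glue := component_glue (K := N x) cC.
have [||SY|PY] := IH (Y :\: C).
- by apply: leq_trans (component_rest cC) Yn.
- by move=> C' /(component_trans cC)/H.
- left; case: SY => n' n'Y bY; have [[n'' n''C bC]|PC] := H C cC.
    by exists (n'' + n'); [rewrite W; nat_lia | apply: glue].
  exists ((m C + cr C [set x]) + n'); first by rewrite W; nat_lia.
  by apply: glue => //; apply: bounded_pure_at.
have [[n'' n''C bC]|PC] := H C cC.
  left; exists (n'' + (m (Y :\: C) + cr (Y :\: C) [set x])); first by rewrite W; nat_lia.
  by apply: glue => //; apply: bounded_pure_at.
right; case: PC => R [rho [P RE Rx]]; case: PY => R' [rho' [P' RE' Rx']].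
have [CY _ _ zC] := cC; have dC := disjointD C Y.
exists (R :|: R'), (fun s => if s \in C then rho s else rho' s); rewrite W.
rewrite {1 4}(component_split cC); split.
- by apply: pure_onU => // a a' aC a'C; rewrite (cross0_adj zC).
- rewrite cardsU disjoint_setI0 ?cards0; first by rewrite subn0 mulnDl RE RE'.
  by apply: disjointWl (pure_sub P) _; apply: disjointWr (pure_sub P') _.
- by move=> y /setUP[/Rx Ry|/Rx' Ry] /Ry; rewrite inE => ->; rewrite ?orbT.
Qed.

(** The vertex [x] leaves no copy in [C], and [C] with its edges to [x] contributes at least
    [k + 1], one short of the price. A strict remainder, the extra edge of [F + e], or a second edge
    to [x] supplies the missing one; otherwise [x |: C] is a new constituent. *)
Lemma detachable_classified S x j C : conn S ->
  (forall A, A \proper S -> conn A -> classified A) ->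
  x \in S -> j <= 1 -> C \subset S :\ x -> Fplus j C -> cr C ((S :\ x) :\: C) = 0 ->
  classified S.
Proof.
move=> cS IH xS j1 CSx FC zC.
have cC : component C (S :\ x).
  split=> //; last exact: Fplus_conn FC.
  by have [u uC _] := Fplus_center FC; apply/set0Pn; exists u.
have xS' : [set x] \subset S by rewrite sub1set.
have x0 : [set x] != set0 by apply/set0Pn; exists x; rewrite set11.
have c0 := component_cross_gt0 cS xS' x0 cC.
set Y := (S :\ x) :\: C in zC *.
have W := component_weight [set x] cC; rewrite -/Y in W.
have mS : m S = (m C + cr C [set x]) + (m Y + cr Y [set x]).
  by rewrite (msizeD1 e_sym e_irr xS) -W cross_sym.
have /and3P[/eqP Cl /eqP mC hC] := FC.
have bC : bounded (C :\: N x) 0.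
  apply: bounded_card; rewrite -Cl -[X in _ < X](cardsID (N x) C) -[X in X < _]add0n ltn_add2r.
  have /cross_gt0P[y [x' [yC /set1P -> yx]]] := c0.
  by apply/card_gt0P; exists y; rewrite inE yC in_nbhd1 e_sym yx orbT.
have bS n : bounded (Y :\: N x) n -> bounded S (n + (k + 2)).
  move=> bY; apply: (bounded1 (x := x)).
  apply: boundedS (component_glue cC bC bY); apply/subsetP => z /setDP[zS zN].
  by rewrite !in_setD zN zS andbT in_set1; apply: contraNneq zN => ->; rewrite in_nbhd1 eqxx.
have [C' cC'|[n nY bY]|PY] := strict_or_pure (x := x) (Y := Y).
- have cC2 := component_trans cC cC'; apply: (component_strict_or_pure cS xS cC2).
  by apply: IH; [apply: component_proper xS' x0 cC2 | case: cC'].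
- by apply: Or44; apply: bounded_le (bS _ bY); nat_lia.
case: (ltnP 1 (j + cr C [set x])) => jc.
  by apply: Or44; apply: bounded_le (bS _ (bounded_pure_at PY)); nat_lia.
apply: Or43; have j0 : j = 0 by nat_lia.
case: PY => R [rho [P RE Rx]]; have xC : x \notin C.
  by apply/negP => /(subsetP CSx); rewrite !inE eqxx.
have xY : x \notin Y by rewrite !inE eqxx andbF.
have SE : S = (x |: C) :|: Y by rewrite -setUA -component_split // setD1K.
have dY : [disjoint x |: C & Y].
  apply/pred0P => z /=; apply/negP => /andP[/setU1P[->|zC']]; first by apply/negP.
  by rewrite inE zC'.
exists ([set x] :|: R), (fun s => if s \in x |: C then x else rho s); split.
  rewrite SE; apply: pure_onU => //.
    have E : (x |: C) :\ x = C by apply: setU1K.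
    apply: pure_on1; rewrite ?setU11 ?E -?j0 // cross_sym //; nat_lia.
  move=> a a' /setU1P[->|aC] a'Y aa'; first by rewrite set11 (Rx a').
  by rewrite (cross0_adj zC aC a'Y) in aa'.
have xR : x \notin R by apply: contra xY; apply: (subsetP (pure_sub P)).
by rewrite cardsU1 xR; nat_lia.
Qed.

Lemma classification S : conn S -> classified S.
Proof.
have [n] := ubnP #|S|; elim: n S => // n IHn S Sn cS.
have IH A : A \proper S -> conn A -> classified A.
  by move=> /proper_card AS; apply: IHn; apply: leq_trans AS Sn.
case: (boolP (hasF S)) => hS; last by apply: Or44; apply: bounded0.
(* Letting [j] range over ['I_2] expresses [j <= 1] inside a boolean. *)
case: (boolP [exists x in S, exists C : {set T}, exists j : 'I_2,
    [&& C \subset S :\ x, Fplus j C & cr C ((S :\ x) :\: C) == 0]]).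
  case/exists_inP=> x xS /existsP[C /existsP[j /and3P[CS FC /eqP zC]]].
  exact: detachable_classified cS IH xS (ltn_ord j) CS FC zC.
move=> nE; apply: no_detachable_classified cS IH _ hS => x j C xS j1 CS FC.
rewrite lt0n; apply: contra nE => zC; apply/exists_inP; exists x => //.
by apply/existsP; exists C; apply/existsP; exists (Ordinal (j1 : j < 2)); rewrite CS FC.
Qed.

(** * The extremal graphs *)

Lemma isolatingE D : isolating e eF D = ~~ hasF (setT :\: closed_nbhd e D).
Proof. by rewrite /hasF setTD setCK. Qed.

Lemma iota_num_le D : isolating e eF D -> iota_num e eF <= #|D|.
Proof.
rewrite /iota_num => iD; have := mem_index_enum D; elim: (index_enum _) => // D' s IHs.
rewrite inE big_cons => /orP[/eqP <-|/IHs Ds]; first by rewrite iD geq_minl.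
by case: ifP => // _; apply: leq_trans (geq_minr _ _) Ds.
Qed.

(** The bound [q <= #|T|] handles the default value of the minimum. *)
Lemma iota_num_ge q : q <= #|T| -> (forall D, isolating e eF D -> q <= #|D|) ->
  q <= iota_num e eF.
Proof.
move=> qT qD; apply: (big_ind (fun n => q <= n)) => // a b qa qb.
by rewrite leq_min qa.
Qed.

Lemma iota_num_bounded n : bounded setT n -> iota_num e eF * (k + 2) <= n.
Proof.
case=> D Dn hD; apply: leq_trans Dn; rewrite leq_mul2r iota_num_le ?orbT //.
by rewrite isolatingE.
Qed.

Lemma connected_graph_conn : connected_graph e -> conn setT.
Proof.
move=> cG A _ /set0Pn[a aA] nA; rewrite lt0n; apply/negP => /eqP zA.
have /set0Pn[b] : setT :\: A != set0.
  by rewrite setD_eq0; apply: contra nA => TA; rewrite eqEsubset subsetT.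
rewrite !inE andbT => bA; have cA : closed e [in A].
  apply: (intro_closed (sym_connect_sym e_sym)) => x y xy xA; apply/negPn/negP => yA.
  by rewrite (cross0_adj zA xA) // !inE yA in xy.
by have := closed_connect cA (cG a b); rewrite aA (negbTE bA).
Qed.

Lemma Fplus_map j C : Fplus j C -> exists f : U -> T, [/\ injective f, f @: setT = C,
  forall u u', eF u u' -> e (f u) (f u') &
  \sum_u \sum_u' (e (f u) (f u') : nat) = 2 * (k + j)].
Proof.
case/and3P=> /eqP Cl /eqP mC /hasFP[f [fI fC fe]].
have fE : f @: setT = C.
  apply/eqP; rewrite eqEcard card_imset // cardsT Cl leqnn andbT.
  by apply/subsetP => _ /imsetP[u _ ->].
by exists f; split=> //; rewrite -cross_image // fE cross_diag // mC.
Qed.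

(** The second summand counts ordered pairs, so each edge beyond those of [F] counts twice. *)
Lemma sum_extra (f : U -> T) : (forall u u', eF u u' -> e (f u) (f u')) ->
  \sum_u \sum_u' (e (f u) (f u') : nat) =
  2 * k + #|[set p : U * U | e (f p.1) (f p.2) && ~~ eF p.1 p.2]|.
Proof.
move=> fe; rewrite -sum_eF !pair_bigA -sum1_card [X in _ = _ + X]big_mkcond -big_split /=.
apply: eq_bigr => -[u u'] _ /=; rewrite inE /=.
by case E: (eF u u'); [rewrite fe | case: (e _ _)].
Qed.

Lemma Fplus0_induced C : Fplus 0 C -> exists f : U -> T, [/\ injective f, f @: setT = C &
  forall u u', e (f u) (f u') = eF u u'].
Proof.
case/Fplus_map=> f [fI fC fe]; rewrite (sum_extra fe) => H; exists f; split=> // u u'.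
have /cards0_eq/setP/(_ (u, u')) :
    #|[set p : U * U | e (f p.1) (f p.2) && ~~ eF p.1 p.2]| = 0 by nat_lia.
by rewrite !inE /=; case E: (eF u u'); [rewrite fe | rewrite andbT].
Qed.

(** The set of extra ordered pairs has two elements and is closed under reversal, so it comes from
    one edge [a b]. *)
Lemma Fplus1_copy : Fplus 1 setT -> copy_of_F_plus_edge eF e.
Proof.
case/Fplus_map=> f [fI fT fe]; rewrite (sum_extra fe) => H.
set E := [set p : U * U | _] in H; have E2 : #|E| = 2 by nat_lia.
have /card_gt0P[[a b] abE] : 0 < #|E| by rewrite E2.
have := abE; rewrite inE /= => /andP[eab nab].
have nE : a != b by apply: contraTneq eab => ->; rewrite e_irr.
have baE : (b, a) \in E by rewrite inE /= e_sym eab eF_sym.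
have EE : E = [set (a, b); (b, a)].
  apply/esym/eqP; rewrite eqEcard E2 cards2 xpair_eqE (negbTE nE) andbT.
  by rewrite subUset !sub1set abE.
exists a, b; split=> //; split=> //; exists f; split.
  apply: inj_card_bij => //; have := card_imset [set: U] fI.
  by rewrite fT !cardsT => ->.
move=> u u'; have /setP/(_ (u, u')) := EE; rewrite !inE !xpair_eqE /= => <-.
by case E' : (eF u u'); [rewrite fe | rewrite andbT].
Qed.

Lemma copy_Fplus1 : copy_of_F_plus_edge eF e -> Fplus 1 setT.
Proof.
case=> a [b [nab [eab [f [fB fe]]]]]; have fI := bij_inj fB.
have fe' u u' : eF u u' -> e (f u) (f u') by move=> uu'; rewrite fe uu'.
have fT : f @: setT = setT.
  by apply/setP => t; rewrite inE; have [g _ gK] := fB; rewrite -(gK t) imset_f.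
rewrite /Fplus; apply/and3P; split.
- by rewrite -fT card_imset // cardsT.
- rewrite -(@eqn_pmul2l 2) // -cross_diag // -fT cross_image // sum_extra //.
  rewrite mulnDr eqn_add2l (_ : [set p | _] = [set (a, b); (b, a)]).
    by rewrite cards2 xpair_eqE (negbTE nab).
  apply/setP => -[u u']; rewrite !inE !xpair_eqE /= fe.
  case: (boolP ((u == a) && (u' == b))) => [/andP[/eqP -> /eqP ->]|_].
    by rewrite orbT (negbTE eab).
  case: (boolP ((u == b) && (u' == a))) => [/andP[/eqP -> /eqP ->]|_];
  by rewrite ?(eF_sym b) ?(negbTE eab) ?orbF ?andbN.
- by apply/hasFP; exists f; split=> // u; rewrite inE.
Qed.

Lemma cross_restrict X Y Y' : Y \subset Y' ->
  (forall x y, x \in X -> y \in Y' -> e x y -> y \in Y) -> cr X Y' = cr X Y.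
Proof.
move=> YY' H; have -> : Y' = Y :|: (Y' :\: Y) by rewrite -{1}(setID Y' Y) (setIidPr YY').
rewrite crossUr ?disjointD // [X in _ + X]cross0 ?addn0 // => x y xX /setDP[yY' yY].
by apply: contra yY; apply: H.
Qed.

(** Each constituent has [k] edges in its fibre and one attaching edge; all other edges lie inside
    [R]. *)
Lemma pure_on_msize S R rho : pure_on S R rho -> m S = m R + #|R| * k.+1.
Proof.
move=> P; pose fib := fiber S R rho; have RS := pure_sub P.
have fibE X : cr (S :\: R) X = \sum_(r in R) cr (fib r) X.
  rewrite /cross (partition_big rho (mem R)) => [|s /setDP[/(pure_rho P)]//].
  by apply: eq_bigr => r _; apply: eq_bigl => s; rewrite [in RHS]inE.
have fibSR r : fib r \subset S :\: R by apply/subsetP => s; rewrite inE => /andP[].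
have fibin r s : s \in fib r -> s \notin R.
  by move/(subsetP (fibSR r)); rewrite inE => /andP[].
have -> : m S = m R + (m (S :\: R) + cr (S :\: R) R).
  by rewrite (msizeD e_sym e_irr RS) cross_sym //; lia.
have -> : cr (S :\: R) R = \sum_(r in R) 1.
  rewrite fibE; apply: eq_bigr => r rR.
  rewrite (cross_restrict (Y := [set r])) ?sub1set //; first
    by rewrite cross_sym // (fiber_cross P).
  move=> s t sF tR st; have [->|tF] := fiber_edge P sF (subsetP RS t tR) st; first exact: set11.
  by rewrite (negbTE (fibin _ _ tF)) in tR.
have H : 2 * m (S :\: R) = \sum_(r in R) 2 * k.
  rewrite -cross_diag // fibE; apply: eq_bigr => r rR.
  rewrite (cross_restrict (Y := fib r)) //.
    by rewrite cross_diag //; case/and3P: (pure_fiber P rR) => _ /eqP -> _; rewrite addn0.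
  move=> s t sF /setDP[tS tR] st; have [tr|//] := fiber_edge P sF tS st.
  by rewrite tr rR in tR.
rewrite !sum_nat_const in H *; congr (_ + _); nia.
Qed.

Lemma pure_pure_special : conn setT -> pure setT -> pure_special (nedges e) eF e.
Proof.
move=> cT [R [rho [P RE]]]; have mR := pure_on_msize P.
have R0 : 0 < #|R| by case: (#|R|) RE.
have /card_gt0P[r0 r0R] := R0.
pose v (i : 'I_#|R|) := enum_val i; have vR i : v i \in R by apply: enum_valP.
have vI : injective v := enum_val_inj.
have [phi phiP] : exists phi : 'I_#|R| -> U -> T, forall i, [/\ injective (phi i),
    phi i @: setT = fiber setT R rho (v i) & forall u u', e (phi i u) (phi i u') = eF u u'].
  have [f fP] := fin_all_exists (fun i => Fplus0_induced (pure_fiber P (vR i))).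
  by exists f.
have phiF i u : phi i u \in fiber setT R rho (v i).
  by have [_ <- _] := phiP i; apply: imset_f; rewrite inE.
have phiR i u : phi i u \notin R by have := phiF i u; rewrite in_fiber => /and3P[].
have phir i u : rho (phi i u) = v i by have := phiF i u; rewrite in_fiber => /and3P[_ _ /eqP].
have [w wP] : exists w : 'I_#|R| -> U, forall i u, e (v i) (phi i u) = (u == w i).
  have H i : exists w, forall u, e (v i) (phi i u) = (u == w).
    have [w wF wP] := pure_attach P (vR i); have [phiI phiE _] := phiP i.
    move: wF; rewrite -phiE => /imsetP[u _ wu]; exists u => u'.
    by rewrite wP // wu (inj_eq phiI).
  by have [f fP] := fin_all_exists H; exists f.
have edge s t : e s t -> rho s = rho t \/ s \in R /\ t \in R.
  by apply: (pure_edge P); rewrite inE.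
have evphi i j u : e (v i) (phi j u) = (i == j) && (u == w j).
  case: (eqVneq i j) => [->|nij] //=; apply/negP => /edge[]; last first.
    by rewrite (negbTE (phiR j u)) => -[].
  by rewrite (pure_fix P) // phir => /vI E; rewrite E eqxx in nij.
exists #|R|; split=> //; split; first by rewrite nedges_msize -RE addn2.
exists v, phi, w; split=> //; split; first by move=> i; have [] := phiP i.
split; first by move=> i j u E; have := phiR j u; rewrite -E vR.
split.
  by move=> i j u u' E; apply: vI; rewrite -(phir i u) E phir.
have inv r : r \in R -> exists i, r = v i.
  by move=> rR; exists (enum_rank_in rR r); rewrite /v enum_rankK_in.
split.
  move=> t; case: (boolP (t \in R)) => tR; first by left; apply: inv.
  right; have [i iE] := inv (rho t) (pure_rho P (in_setT t)).
  have : t \in fiber setT R rho (v i) by rewrite in_fiber tR in_setT iE eqxx.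
  by have [_ <- _] := phiP i => /imsetP[u _ ->]; exists i, u.
split; last first.
  split=> //; split=> [i j u|i j u u']; first by rewrite e_sym.
  case: (eqVneq i j) => [->|nij] /=; first by have [_ _ ->] := phiP j.
  apply/negP => /edge[]; last by rewrite (negbTE (phiR i u)) => -[].
  by rewrite !phir => /vI E; rewrite E eqxx in nij.
set eR := [rel a b | _]; split; last first.
  have sR : symmetric eR by move=> a b; rewrite /= e_sym.
  have iR : irreflexive eR by move=> a; rewrite /= e_irr.
  (* The edge count of [pure] and [pure_on_msize] leave exactly [#|R| - 1] edges inside [R]. *)
  suff : cross eR setT setT = cr R R.
    rewrite !cross_diag // -nedges_msize; move: mR RE; rewrite -/k; nia.
  have RE' : R = v @: setT.
    apply/setP => r; apply/idP/imsetP => [/inv[i ->]|[i _ ->]]; last exact: vR.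
    by exists i; rewrite ?inE.
  rewrite [in RHS]RE' /cross big_imset /=; last by move=> ? ? _ _ /vI.
  by apply: eq_bigr => i _; rewrite big_imset //= => ? ? _ _ /vI.
move=> i j; pose idx s := enum_rank_in r0R (rho s).
have vidx s : v (idx s) = rho s by rewrite /v enum_rankK_in // (pure_rho P) // inE.
have idxv a : idx (v a) = a by apply: vI; rewrite vidx (pure_fix P).
(* The vertices whose constituent is reachable from [i] in the quotient. An edge leaving this set
   would join two connection vertices and extend the reach. *)
pose A := [set s | connect eR i (idx s)].
case: (eqVneq A setT) => [/setP/(_ (v j))|nA]; first by rewrite !inE idxv.
have A0 : A != set0 by apply/set0Pn; exists (v i); rewrite inE idxv.
case/cross_gt0P: (cT A (subsetT _) A0 nA) => s [t [sA]].
rewrite !inE andbT => /negP tA st; case: tA; move: sA; rewrite inE.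
have [E|[sR tR]] := edge s t st; first by rewrite /idx E.
move/connect_trans; apply; apply: connect1.
by rewrite /= !vidx !(pure_fix P).
Qed.

(** The connection vertices isolate, as they also dominate each [w i]. Conversely an isolating set
    meets every constituent: outside its copy, only the connection vertex is adjacent to that
    copy. *)
Lemma pure_special_iota n : pure_special n eF e -> iota_num e eF * (k + 2) = n.+1.
Proof.
case=> q [q0 [-> [v [phi [w [vI [phiI [vphi [phiphi [cover [_ [evphi [ephiv ephi]]]]]]]]]]]]].
rewrite -/k addn2; congr (_ * _); apply/eqP; rewrite eqn_leq; apply/andP; split.
  have <- : #|v @: setT| = q by rewrite card_imset // cardsT card_ord.
  apply: iota_num_le; rewrite isolatingE; apply/negP => /hasF_star[W [z [sW zW Wl _ zP]]].
  have nv y i : y \in W -> y != v i /\ y != phi i (w i).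
    move/(subsetP sW)/setDP => [_ yN]; split; apply: contraNneq yN => ->.
      by rewrite in_nbhd; apply/exists_inP; exists (v i); rewrite ?eqxx ?imset_f.
    rewrite in_nbhd; apply/exists_inP; exists (v i); first by rewrite imset_f.
    by rewrite evphi !eqxx orbT.
  have inphi y : y \in W -> exists i u, y = phi i u.
    by case: (cover y) => [[i ->]|//] /(nv _ i)[]; rewrite eqxx.
  have [i [u zE]] := inphi z zW.
  (* A surviving copy would fit into [F_i] without its attaching vertex, that is, into [l - 1]
     vertices. *)
  suff /subset_leq_card : W \subset phi i @: [set~ w i].
    by rewrite card_imset // cardsC1 Wl -/l; have := order_F_ge3; nat_lia.
  apply/subsetP => y yW; have [j [u' yE]] := inphi y yW.
  have ij : i = j.
    case: (eqVneq y z) => [yz|nyz]; first by apply: (phiphi _ _ u u'); rewrite -zE -yE.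
    by have := zP y yW nyz; rewrite zE yE ephi => /andP[/eqP].
  rewrite yE -ij imset_f // !inE; apply: contraTneq yW => uw.
  by apply/negP => /(nv _ i)[_]; rewrite yE -ij uw eqxx.
apply: iota_num_ge => [|D iD]; first by rewrite -[q]card_ord; apply: leq_card vI.
have /fin_all_exists[d dP] i : exists t, t \in D /\ (t = v i \/ exists u, t = phi i u).
  case: (boolP (v i \in D)) => viD; first by exists (v i); split; [|left].
  case: (boolP [exists u, phi i u \in D]) => [/existsP[u uD]|/existsPn nD].
    by exists (phi i u); split=> //; right; exists u.
  case/negP: iD; apply/existsP; exists [ffun u => phi i u]; apply/and3P; split.
  - by apply/injectiveP => u u'; rewrite !ffunE => /phiI.
  - apply/forallP => u; rewrite ffunE in_nbhd; apply/exists_inPn => y yD; rewrite negb_or.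
    apply/andP; split; first by apply: contraNneq (nD u) => <-.
    apply/negP; case: (cover y) => [[j yE]|[j [u' yE]]]; rewrite yE in yD *.
      by rewrite evphi => /andP[/eqP ji _]; rewrite -ji yD in viD.
    by rewrite ephi => /andP[/eqP ji _]; have := nD u'; rewrite -ji yD.
  - by apply/forallP => u; apply/forallP => u'; rewrite !ffunE ephi eqxx; apply/implyP.
have dI : injective d.
  move=> i j E; have [_ di] := dP i; have [_ dj] := dP j; rewrite -E in dj.
  case: di dj => [->|[u ->]] [|[u' E']]; [exact: vI|by case: (vphi i j u')| |exact: phiphi E'].
  by move=> E'; case: (vphi j i u).
rewrite -[q]card_ord -cardsT -(card_imset _ dI); apply: subset_leq_card.
by apply/subsetP => _ /imsetP[i _ ->]; case: (dP i).
Qed.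

Lemma iota_num_gt0 : hasF setT -> 0 < iota_num e eF.
Proof.
move=> hT; apply: iota_num_ge => [|D]; first by rewrite -cardsT;
  have := hasF_card hT; have := order_F_ge3; nat_lia.
rewrite isolatingE card_gt0; apply: contraNneq => ->; apply: hasFS hT.
apply/subsetP => t _; rewrite inE in_nbhd inE andbT.
by apply/exists_inPn => y; rewrite inE.
Qed.

Lemma iota_numE : connected_graph e ->
  (iota_num e eF * (k + 2) = (nedges e).+1 <->
   pure_special (nedges e) eF e \/ copy_of_F_plus_edge eF e).
Proof.
move=> /connected_graph_conn cT; have mT := nedges_msize e.
split=> [H|[/pure_special_iota //|/copy_Fplus1 FT]]; last first.
  (* Here [m + 1 = k + 2], and one centre suffices while the empty set does not, so the number is
     1. *)
  have := iota_num_bounded (bounded_Fplus FT); case/and3P: FT => _ /eqP mF /iota_num_gt0.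
  rewrite mT mF; case: (iota_num e eF) => [//|[|i]] _; nia.
case: (classification cT) => [FT|FT|pT|bT].
(* For a copy of [F] the right-hand side is [k + 1], less than any positive multiple of [k + 2]. *)
- have := iota_num_bounded (bounded_Fplus FT); case/and3P: FT => _ /eqP mF /iota_num_gt0.
  by rewrite H mT mF; move: H; rewrite mT mF; case: (iota_num e eF) => [//|i] H _; nia.
- by right; apply: Fplus1_copy.
- by left; apply: pure_pure_special.
- by have := iota_num_bounded bT; rewrite H mT ltnn.
Qed.

End Isolation.

Theorem theorem1p2 (k : nat) (U : finType) (eF : rel U)
    (eF_sym : symmetric eF) (eF_irr : irreflexive eF)
    (T : finType) (e : rel T) (e_sym : symmetric e) (e_irr : irreflexive e)
    (m : nat) :
  3 <= k -> nedges eF = k -> has_dominating_vertex eF ->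
  connected_graph e -> nedges e = m ->
  (iota_num e eF * (k + 2) = m + 1 <->
     pure_special m eF e \/ copy_of_F_plus_edge eF e).
Proof.
move=> k3 kE dom cG <-; rewrite -kE addn1; apply: iota_numE => //.
by rewrite kE.
Qed.
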